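(* Assume that $z\in\mathbb C\setminus\mathbb Z$. (i) There exists a unique (bounded linear) operator $A_z$ intertwining the representations $T_z$ and $T_{\bar z}$ of $G$ and mapping the distinguished vector of $T_z$ to the distinguished vector of $T_{\bar z}$. (ii) Realize $T_z$ and $T_{\bar z}$ as inductive limits of the representations $\mathrm{Reg}^n$. Then, for all $n=1,2,\dots$, the operator $A_z$ preserves the subspaces $H^n$ (it maps $H^n\subset H(T_z)$ into $H^n\subset H(T_{\bar z})$), hence determines an operator $A_{n,z}:H^n\to H^n$ commuting with the representation $\mathrm{Reg}^n$. (iii) The operator $A_{n,z}$ on the space $H^n$ is the operator of convolution with the central function $$\Theta_{n,z}=\sum_{\lambda\vdash n}\left(\prod_{b\in\lambda}\frac{\bar z+c(b)}{z+c(b)}\right)\dim\lambda\cdot\chi^\lambda .$$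
   Context: $S(n)$ is the group of permutations of $\{1,\dots,n\}$, identified with the stabilizer of $n+1$ in $S(n+1)$; $S(\infty)=\bigcup_n S(n)$; $G=S(\infty)\times S(\infty)$, $G(n)=S(n)\times S(n)$. The canonical projection $p_{n,n+1}:S(n+1)\to S(n)$ removes $n+1$ from its cycle: for $1\le i\le n$, $(p_{n,n+1}(x))(i)=x(i)$ if $x(i)\le n$, and $=x(n+1)$ if $x(i)=n+1$. $H^n=L^2(S(n))$ with respect to the uniform probability measure $\mu_1^n$; $\mathrm{Reg}^n$ is the representation of $G(n)$ in $H^n$, $(\mathrm{Reg}^n(g)f)(x)=f(g_2^{-1}xg_1)$. For $z\in\mathbb C$, $t=|z|^2$, the isometric $G(n)$-equivariant embedding $L_z^n:H^n\to H^{n+1}$ is $(L_z^nf)(x)=z\sqrt{\frac{n+1}{t+n}}f(x)$ for $x\in S(n)$ and $(L_z^nf)(x)=\sqrt{\frac{n+1}{t+n}}f(p_{n,n+1}(x))$ for $x\in S(n+1)\setminus S(n)$. The representation $T_z$ of $G$ is the inductive limit of the $\mathrm{Reg}^n$ along the $L_z^n$; it acts in the Hilbert completion $H(T_z)$ of $\bigcup_nH^n$. For $s\in S(n)$, $[s]$ is the number of cycles. The distinguished vector of $T_z$ ($z\in\mathbb C\setminus\{0\}$) is the unit vector represented, in each $H^n$, by the function $F_z^n(x)=\left(\frac{n!}{t(t+1)\cdots(t+n-1)}\right)^{1/2}z^{[x]}$ (one has $L_z^nF_z^n=F_z^{n+1}$). Convolution is with respect to $\mu_1^n$: $(f*h)(x)=\frac1{n!}\sum_{y\in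 S(n)}f(xy^{-1})h(y)$. For a Young diagram $\lambda\vdash n$ ($n$ boxes), $\chi^\lambda$ is the irreducible character of $S(n)$ indexed by $\lambda$, $\dim\lambda=\chi^\lambda(e)$, and $c(b)=j-i$ is the content of a box $b=(i,j)$ (row $i$, column $j$). *)

(* Defs.v *)
From HB Require Import structures.
From mathcomp Require Import all_boot all_order all_fingroup all_algebra.
From mathcomp Require Import sesquilinear mxrepresentation complex.
From mathcomp Require Import all_classical all_reals topology normedtype.

Set Implicit Arguments.
Unset Strict Implicit.
Unset Printing Implicit Defensive.

Import Order.TTheory GRing.Theory Num.Theory.
Import numFieldNormedType.Exports.

Local Open Scope ring_scope.

(** * Permutations

    S(n) is ['S_n], acting on {0, ..., n-1} rather than {1, ..., n}; the last
    point n+1 moved by S(n+1) is thus [ord_max : 'I_n.+1].  Products in S(n) are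
    composed from right to left, [(x \p y) i = x (y i)], whereas MathComp's
    [x * y] applies x first.  *)
Notation "x \p y" := (y * x)%g (at level 40, left associativity, only parsing).

(** x lies in S(n), the stabilizer of the last point in S(n+1). *)
Definition in_subgroup n (x : 'S_n.+1) : bool := x ord_max == ord_max.

Section CanonicalProjection.
Variables (n : nat) (x : 'S_n.+1).

Definition proj_fun (i : 'I_n) : 'I_n :=
  if unlift ord_max (x (lift ord_max i)) is Some k then k
  else odflt i (unlift ord_max (x ord_max)).

Lemma proj_fun_lift (i : 'I_n) :
  lift ord_max (proj_fun i) =
  if x (lift ord_max i) == ord_max then x ord_max else x (lift ord_max i).
Proof.
rewrite /proj_fun; case: unliftP => [k ->|Ei].
  by rewrite eq_sym (negPf (neq_lift _ _)).
rewrite Ei eqxx; case: unliftP => [k -> //|Em].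
by have /perm_inj/eqP := etrans Ei (esym Em); rewrite eq_sym (negPf (neq_lift _ _)).
Qed.

Lemma proj_fun_inj : injective proj_fun.
Proof.
move=> i j Eij; have := congr1 (lift ord_max) Eij; rewrite !proj_fun_lift.
case: eqP => [Ei|_]; case: eqP => [Ej|_] E.
- by apply: (@lift_inj _ ord_max); apply: (@perm_inj _ x); rewrite Ei Ej.
- by move/perm_inj/eqP: E; rewrite (negPf (neq_lift _ _)).
- by move/perm_inj/eqP: E; rewrite eq_sym (negPf (neq_lift _ _)).
- by apply: (@lift_inj _ ord_max); apply: (@perm_inj _ x).
Qed.

(** The canonical projection S(n+1) -> S(n): remove n+1 from its cycle. *)
Definition proj_perm : 'S_n := perm proj_fun_inj.

End CanonicalProjection.

Definition widen_perm n (s : 'S_n) : 'S_n.+1 := lift_perm ord_max ord_max s.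

Lemma widen_permX n (s : 'S_n) k i :
  (widen_perm s ^+ k)%g (lift ord_max i) = lift ord_max ((s ^+ k)%g i).
Proof. by elim: k => [|k IH]; rewrite ?perm1 // !expgSr !permM IH lift_perm_lift. Qed.

Lemma card_porbits_widen n (s : 'S_n) :
  #|porbits (widen_perm s)| = #|porbits s|.+1.
Proof.
have E i : porbit (widen_perm s) (lift ord_max i) = [set lift ord_max j | j in porbit s i].
  apply/setP => j; apply/porbitP/imsetP => [[k ->]|[_ /porbitP[k ->] ->]].
    by exists ((s ^+ k)%g i); [apply/porbitP; exists k|rewrite widen_permX].
  by exists k; rewrite widen_permX.
have Em : porbit (widen_perm s) ord_max = [set ord_max].
  apply/setP => j; rewrite inE; apply/porbitP/eqP => [[k ->]|->]; last by exists 0%N; rewrite perm1.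
  by elim: k => [|k IH]; rewrite ?perm1 // expgSr permM IH lift_perm_id.
pose h (A : {set 'I_n}) : {set 'I_n.+1} := [set lift ord_max j | j in A].
have hI : injective h by move=> A B /setP AB; apply/setP=> i; have := AB (lift ord_max i); rewrite !mem_imset //; apply: lift_inj.
have -> : porbits (widen_perm s) = [set ord_max] |: [set h A | A in porbits s].
  apply/setP=> A; rewrite !inE; apply/imsetP/orP => [[i _ ->]|].
    case: (unliftP ord_max i) => [j ->|->]; last by rewrite Em eqxx; left.
    by right; rewrite E; apply: (imset_f h); apply: imset_f.
  case=> [/eqP ->|/imsetP[_ /imsetP[j _ ->] ->]]; first by exists ord_max; rewrite ?Em.
  by exists (lift ord_max j); rewrite ?E.
rewrite cardsU1 card_imset // -[RHS]add1n; congr (_ + _)%N.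
apply/eqP; rewrite eqb1; apply/imsetP => -[A _ /setP/(_ ord_max)].
by rewrite inE eqxx => /esym/imsetP[j _ /eqP]; rewrite (negPf (neq_lift _ _)).
Qed.

Lemma widen_proj_perm n (x : 'S_n.+1) :
  widen_perm (proj_perm x) = (tperm ord_max (x^-1%g ord_max) * x)%g.
Proof.
apply/permP => i; rewrite permM.
case: (unliftP ord_max i) => [j ->|->]; last by rewrite lift_perm_id tpermL permKV.
rewrite lift_perm_lift permE proj_fun_lift.
case: tpermP => [/eqP|->|_ /eqP H].
- by rewrite eq_sym (negPf (neq_lift _ _)).
- by rewrite permKV eqxx.
by rewrite (canF_eq (permK x)) (negPf H).
Qed.

Lemma card_porbits_proj n (x : 'S_n.+1) :
  #|porbits x| = (#|porbits (proj_perm x)| + in_subgroup x)%N.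
Proof.
apply: succn_inj; have := porbits_mul_tperm x ord_max (x^-1%g ord_max).
rewrite /= -widen_proj_perm card_porbits_widen.
have -> : ord_max \in porbit x (x^-1%g ord_max).
  by rewrite -{1}(permKV x ord_max); exact: (mem_porbit x 1).
rewrite addn0 /in_subgroup (canF_eq (permK x)).
by case: eqP => _ /=; rewrite addn0 ?addn1 => <-.
Qed.

Lemma widen_perm_inj n : injective (@widen_perm n).
Proof.
move=> s t /permP E; apply/permP => i; apply: (@lift_inj _ ord_max).
by have := E (lift ord_max i); rewrite !lift_perm_lift.
Qed.

Lemma widen_permM n : {morph @widen_perm n : s t / (s * t)%g}.
Proof. by move=> s t; rewrite /widen_perm lift_permM. Qed.

Lemma widen_proj_permE n (x : 'S_n.+1) :
  widen_perm (proj_perm x) = (x * tperm (x ord_max) ord_max)%g.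
Proof.
by rewrite widen_proj_perm conjgC tpermJ permKV.
Qed.

Lemma proj_permM n (g h : 'S_n) (x : 'S_n.+1) :
  proj_perm (widen_perm g * x * widen_perm h)%g = (g * proj_perm x * h)%g.
Proof.
apply: widen_perm_inj; rewrite !widen_permM !widen_proj_permE -!mulgA; congr (_ * (_ * _))%g.
by rewrite [RHS]conjgC tpermJ !permM !lift_perm_id.
Qed.

Lemma in_subgroupM n (g h : 'S_n) (x : 'S_n.+1) :
  in_subgroup (widen_perm g * x * widen_perm h)%g = in_subgroup x.
Proof.
rewrite /in_subgroup !permM lift_perm_id -{2}(lift_perm_id ord_max ord_max h).
by rewrite (inj_eq perm_inj).
Qed.

(** ** The infinite symmetric group *)

Definition finitary (f : nat -> nat) : Prop :=
  bijective f /\ exists n, forall i, (n <= i)%N -> f i = i.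

Record Sinf := MkSinf { sinf_fun :> nat -> nat; sinfP : finitary sinf_fun }.

Lemma sinf_ext (s t : Sinf) : s =1 t -> s = t.
Proof.
case: s t => f Pf [g Pg] /= /funext E; subst g.
by congr MkSinf; apply: Prop_irrelevance.
Qed.

HB.instance Definition _ := gen_eqMixin Sinf.
HB.instance Definition _ := gen_choiceMixin Sinf.

Lemma finitary_id : finitary id.
Proof. by split; [exists id|exists 0%N]. Qed.

Lemma finitary_comp f g : finitary f -> finitary g -> finitary (f \o g).
Proof.
move=> [bf [m Hm]] [bg [n Hn]]; split; first exact: bij_comp.
exists (maxn m n) => i; rewrite geq_max => /andP[mi ni] /=.
by rewrite Hn ?Hm.
Qed.

Lemma sinf_inv_subproof (s : Sinf) :
  {g : nat -> nat | finitary g /\ cancel s g /\ cancel g s}.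
Proof.
apply: cid; have [[g sK gK] [n Hn]] := sinfP s; exists g; split=> //.
split; first by exists (s : nat -> nat).
by exists n => i ni; rewrite -{1}(Hn i ni) sK.
Qed.

Definition sinf_one : Sinf := MkSinf finitary_id.
Definition sinf_mul (s t : Sinf) : Sinf := MkSinf (finitary_comp (sinfP s) (sinfP t)).
Definition sinf_inv (s : Sinf) : Sinf := MkSinf (svalP (sinf_inv_subproof s)).1.

Lemma sinf_mulA : associative sinf_mul.
Proof. by move=> s t u; apply: sinf_ext. Qed.
Lemma sinf_mul1 : left_id sinf_one sinf_mul.
Proof. by move=> s; apply: sinf_ext. Qed.
Lemma sinf_1mul : right_id sinf_one sinf_mul.
Proof. by move=> s; apply: sinf_ext. Qed.
Lemma sinf_mulV : left_inverse sinf_one sinf_inv sinf_mul.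
Proof. by move=> s; apply: sinf_ext => i /=; case: sinf_inv_subproof => g /= [_ []]. Qed.
Lemma sinf_Vmul : right_inverse sinf_one sinf_inv sinf_mul.
Proof. by move=> s; apply: sinf_ext => i /=; case: sinf_inv_subproof => g /= [_ []]. Qed.

(** Right-to-left composition: [(s * t)%g i = s (t i)] for [s t : Sinf]. *)
HB.instance Definition _ :=
  isGroup.Build Sinf sinf_mulA sinf_mul1 sinf_1mul sinf_mulV sinf_Vmul.

Section FinitePermInSinf.
Variables (n : nat) (s : 'S_n).

Definition sinf_of_fun (i : nat) : nat := if insub i is Some j then s j else i.

Lemma sinf_of_fun_finitary : finitary sinf_of_fun.
Proof.
split; last by exists n => i ni; rewrite /sinf_of_fun insubF // ltnNge ni.
exists (fun i => if insub i is Some j then (s^-1)%g j : nat else i) => i;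
  rewrite /sinf_of_fun; case: (insubP _ i) => [j _ <-|ni];
  by rewrite ?valK ?permK ?permKV // insubN.
Qed.

Definition sinf_of : Sinf := MkSinf sinf_of_fun_finitary.

End FinitePermInSinf.

Lemma sinf_of_widen n (s : 'S_n) : sinf_of (widen_perm s) = sinf_of s.
Proof.
apply: sinf_ext => i; rewrite /= /sinf_of_fun.
case: (insubP _ i) => [j _ <-|ni]; last first.
  by rewrite insubN //; apply: contra ni => /ltnW.
case: (unliftP ord_max j) => [k ->|->].
  rewrite /widen_perm lift_perm_lift [X in insub X]lift_max.
  by rewrite lift_max insubT //= => H; congr (nat_of_ord (s _)); apply: val_inj.
by rewrite /widen_perm lift_perm_id insubN //= ltnn.
Qed.

Notation Ginf := (Sinf * Sinf)%type.

(** * Hilbert spaces and unitary representations *)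

Record hilbertType (R : realType) := Hilbert {
  hilbert_sort :> completeNormedModType R[i];
  inner : {dot hilbert_sort for Num.conj};
  norm_inner : forall v : hilbert_sort, `|v| ^+ 2 = inner v v }.
Arguments inner {R} h.

Definition bounded_operator (R : realType) (H K : hilbertType R)
    (A : {linear H -> K}) : Prop :=
  exists M : R, forall v : H, `|A v| <= (M%:C)%C * `|v|.

Record unitary_rep (R : realType) (G : groupType) (H : hilbertType R) :=
  UnitaryRep {
    rep_fun :> G -> {linear H -> H};
    rep_1 : forall v, rep_fun 1%g v = v;
    rep_M : forall g h v, rep_fun (g * h)%g v = rep_fun g (rep_fun h v);
    rep_unitary : forall g u v, inner H (rep_fun g u) (rep_fun g v) = inner H u v }.

Definition intertwines (R : realType) (G : groupType) (H K : hilbertType R)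
    (T : unitary_rep G H) (T' : unitary_rep G K) (A : {linear H -> K}) : Prop :=
  forall (g : G) (v : H), A (T g v) = T' g (A v).

(** * The spaces H^n and the representations Reg^n *)

Section Hn.
Variable R : realType.
Local Notation C := R[i].

Definition Hn (n : nat) : lmodType C := {ffun 'S_n -> C^o}.

(** Inner product for the uniform probability measure. *)
Definition inner_Hn n (f h : Hn n) : C :=
  (n`!%:R)^-1 * \sum_(x : 'S_n) f x * (h x)^*.

Definition Reg n (g : 'S_n * 'S_n) (f : Hn n) : Hn n :=
  [ffun x : 'S_n => f (g.2^-1 \p x \p g.1)].

Definition convolution n (f h : Hn n) : Hn n :=
  [ffun x : 'S_n => (n`!%:R)^-1 * \sum_(y : 'S_n) f (x \p y^-1) * h y].

(** [proj_perm x] is x itself, seen as an element of S(n), when x is in the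
    subgroup S(n) of S(n+1). *)
Definition Lz (z : C) n (f : Hn n) : Hn n.+1 :=
  let c := sqrtC (n.+1%:R / (`|z| ^+ 2 + n%:R)) in
  [ffun x : 'S_n.+1 =>
     if in_subgroup x then z * c * f (proj_perm x) else c * f (proj_perm x)].

Definition Fz (z : C) n : Hn n :=
  [ffun x : 'S_n => sqrtC (n`!%:R / \prod_(0 <= k < n) (`|z| ^+ 2 + k%:R)) *
                    z ^+ #|porbits x|].

Lemma Lz_isometric (z : C) n (f h : Hn n) : (0 < n)%N ->
  inner_Hn (Lz z f) (Lz z h) = inner_Hn f h.
Proof.
move=> n0; rewrite /inner_Hn.
pose F (x : 'S_n.+1) := Lz z f x * (Lz z h x)^*.
pose c := sqrtC (n.+1%:R / (`|z| ^+ 2 + n%:R) : R[i]).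
pose G (s : 'S_n) := f s * (h s)^*.
have t0 : 0 < `|z| ^+ 2 + n%:R by rewrite ltr_wpDl ?exprn_ge0 ?ltr0n.
have cc : c * c^* = n.+1%:R / (`|z| ^+ 2 + n%:R).
  have c0 : 0 <= c by rewrite sqrtC_ge0 divr_ge0 // ltW.
  by rewrite conj_Creal ?ger0_real // -expr2 sqrtCK.
have FE x : F x = (if in_subgroup x then `|z| ^+ 2 else 1) * (n.+1%:R / (`|z| ^+ 2 + n%:R)) * G (proj_perm x).
  rewrite /F !ffunE -/c -cc normCK; case: in_subgroup; rewrite ?mul1r ?rmorphM /G.
    by rewrite [LHS]mulrACA [X in X * _ = _]mulrACA.
  by rewrite mulrACA.
have bij (x : 'S_n.+1) : x = (tperm ord_max (x^-1%g ord_max) * widen_perm (proj_perm x))%g.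
  by rewrite widen_proj_perm mulgA tperm2 mul1g.
rewrite (reindex (fun p : 'S_n * 'I_n.+1 => (tperm ord_max p.2 * widen_perm p.1)%g)); last first.
  exists (fun x : 'S_n.+1 => (proj_perm x, x^-1%g ord_max)) => [[s i] _|x _] /=; last by rewrite -bij.
  have E : ((tperm ord_max i * widen_perm s)^-1)%g ord_max = i.
    rewrite invMg permM tpermV /widen_perm lift_permV lift_perm_id.
    by rewrite tpermL.
  rewrite E; congr pair; apply: widen_perm_inj; rewrite widen_proj_perm E mulgA tperm2 mul1g.
  by [].
have FE2 (p : 'S_n * 'I_n.+1) : F (tperm ord_max p.2 * widen_perm p.1)%g =
   G p.1 * ((n.+1%:R / (`|z| ^+ 2 + n%:R)) * (if p.2 == ord_max then `|z| ^+ 2 else 1)).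
  rewrite FE; set x := (_ * _)%g.
  have E : (x^-1)%g ord_max = p.2.
    by rewrite invMg permM tpermV /widen_perm lift_permV lift_perm_id tpermL.
  have -> : proj_perm x = p.1.
    by apply: widen_perm_inj; rewrite widen_proj_perm E mulgA tperm2 mul1g.
  rewrite /in_subgroup (canF_eq (permK x)) E eq_sym mulrC [X in _ * X]mulrC.
  by [].
under eq_bigr => p _ do rewrite (FE2 p : _ * _ = _).
rewrite -(pair_bigA _ (fun s i => G s * ((n.+1%:R / (`|z| ^+ 2 + n%:R)) * (if i == ord_max then `|z| ^+ 2 else 1)))) /=.
under eq_bigr => s _.
  rewrite -mulr_sumr -mulr_sumr.
  have -> : \sum_(i < n.+1) (if i == ord_max then `|z| ^+ 2 else 1) = `|z| ^+ 2 + n%:R :> R[i].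
    rewrite big_ord_recr /= eqxx addrC; congr (_ + _).
    under eq_bigr => i _ do rewrite -val_eqE /= ltn_eqF //.
    by rewrite sumr_const card_ord.
  rewrite divfK ?gt_eqF //.
  over.
by rewrite -mulr_suml factS natrM invfM [X in _ * X]mulrC mulrACA mulVf ?pnatr_eq0 // mul1r.
Qed.

Lemma Lz_equivariant (z : C) n (g : 'S_n * 'S_n) f :
  Lz z (Reg g f) = Reg (widen_perm g.1, widen_perm g.2) (Lz z f).
Proof.
apply/ffunP => x; rewrite !ffunE /= !mulgA /=.
have -> : ((widen_perm g.2)^-1 = widen_perm g.2^-1)%g by rewrite /widen_perm lift_permV.
by rewrite in_subgroupM proj_permM ?mulgA.
Qed.

Lemma Lz_Fz (z : C) n : Lz z (Fz z n) = Fz z n.+1.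
Proof.
apply/ffunP => x; rewrite !ffunE (card_porbits_proj x).
set a := _ / (_ + _); set b := _ / \prod_(_ <= _ < n) _.
have -> : (n.+1)`!%:R / \prod_(0 <= k < n.+1) (`|z| ^+ 2 + k%:R) = a * b.
  by rewrite /a /b big_nat_recr //= factS natrM mulf_div [X in _ / X]mulrC.
have a_ge0 : 0 <= a by rewrite divr_ge0 ?addr_ge0 ?exprn_ge0.
have -> : sqrtC (a * b) = sqrtC a * sqrtC b by apply: rootCMl.
case: in_subgroup => /=; last by rewrite addn0 mulrA.
rewrite addn1 exprS; move: (sqrtC a) (sqrtC b) (z ^+ _) => u v w.
by rewrite [RHS]mulrACA [u * z]mulrC.
Qed.

(** Realizations of T_z: a Hilbert space containing compatible isometric copies
    of the H^n, n >= 1, with dense union, and a unitary representation of G on it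
    which extends the Reg^n.  Any two are related by a unique isomorphism
    compatible with all the [emb n].  [emb 0] is left unconstrained.  The
    conditions are consistent by [Lz_isometric], [Lz_equivariant] and
    [sinf_of_widen]. *)
Record Tz_realization (z : C) := TzRealization {
  Tz_space :> hilbertType R;
  Tz_rep : unitary_rep Ginf Tz_space;
  emb : forall n, {linear Hn n -> Tz_space};
  emb_isometric : forall n, (0 < n)%N -> forall f h : Hn n,
    inner Tz_space (emb n f) (emb n h) = inner_Hn f h;
  emb_compatible : forall n, (0 < n)%N -> forall f : Hn n,
    emb n.+1 (Lz z f) = emb n f;
  emb_dense :
    dense [set v : Tz_space | exists n (f : Hn n), (0 < n)%N /\ v = emb n f];
  emb_equivariant : forall n, (0 < n)%N -> forall (g : 'S_n * 'S_n) (f : Hn n),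
    Tz_rep (sinf_of g.1, sinf_of g.2) (emb n f) = emb n (Reg g f) }.

(** The vector represented by [Fz z n] in every H^n with n >= 1, by [Lz_Fz]
    and [emb_compatible]. *)
Definition distinguished z (T : Tz_realization z) : T := emb T 1 (Fz z 1).

End Hn.

(** * Young diagrams and irreducible characters of S(n) *)

(** The tuple of the row lengths, padded with zeros to length n. *)
Definition is_young n (la : n.-tuple 'I_n.+1) : bool :=
  sorted geq (map val la) && (sumn (map val la) == n).

Definition young (n : nat) : finType := {la : n.-tuple 'I_n.+1 | is_young la}.

Definition rows n (la : young n) : seq nat := map val (val la).

(** The box (i, j), where rows and columns are numbered from 0. *)
Definition in_diagram n (la : young n) (b : 'I_n * 'I_n) : bool :=
  (b.2 < nth 0 (rows la) b.1)%N.

Definition content n (b : 'I_n * 'I_n) : int := b.2%:Z - b.1%:Z.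

Section SpechtModules.
Variables (R : realType) (n : nat) (la : young n).
Local Notation C := R[i].

(** Rows and columns of the points of ['I_n] in the tableau of shape la filled
    with 0, ..., n-1 row by row from left to right. *)
Definition tableau_row (k : 'I_n) : nat := reshape_index (rows la) k.
Definition tableau_col (k : 'I_n) : nat := reshape_offset (rows la) k.

Definition row_group : {set 'S_n} :=
  [set p : 'S_n | [forall k, tableau_row (p k) == tableau_row k]].
Definition col_group : {set 'S_n} :=
  [set q : 'S_n | [forall k, tableau_col (q k) == tableau_col k]].

Local Notation regular := (regular_repr C [set: 'S_n]%G).

Definition young_symmetrizer : 'rV[C]_#|[set: 'S_n]%G| :=
  \sum_(p in row_group) \sum_(q in col_group)
    (-1) ^+ q *: gring_row (regular (p \p q)).

(** [regular] acts by x |-> x * g = g \p x on the basis of the group algebra, so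
    for the product \p the module below is the left ideal generated by the Young
    symmetrizer, on which S(n) acts by left multiplication. *)
Definition specht_repr :=
  submod_repr (cyclic_mx_module regular young_symmetrizer).

Definition irr_char (x : 'S_n) : C := \tr (specht_repr x).

Definition dim_char : C := irr_char 1%g.

End SpechtModules.
Arguments irr_char {R n} la x.
Arguments dim_char {R n} la.

Definition Theta (R : realType) (z : R[i]) (n : nat) : Hn R n :=
  [ffun x : 'S_n =>
    \sum_(la : young n)
      (\prod_(b : 'I_n * 'I_n | in_diagram la b)
         ((z^* + (content b)%:~R) / (z + (content b)%:~R)))
      * dim_char la * irr_char la x].

Definition central (R : realType) n (f : Hn R n) : Prop :=
  forall x y : 'S_n, f (x \p y) = f (y \p x).

(* Main.v *)
From HB Require Import structures.
Require Import Defs.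
From mathcomp Require Import all_boot all_order all_fingroup all_algebra.
From mathcomp Require Import pgroup sesquilinear mxrepresentation complex.
From mathcomp Require Import all_classical all_reals topology normedtype.
From mathcomp Require Import zify ring.

(* In the group algebra of S(n), the element sum_x z^[x] x acts on the Specht
   module of la by the scalar prod_b (z + c(b)).  Indeed B x A is a multiple of
   B A for every x, where A and B are the row and column symmetrizers, so the
   scalar is sum_{p,q} sgn(q) z^[qp] over the row and column groups, and removing
   the last box of la multiplies this sum by z + c(b).  Since the Specht modules
   exhaust the irreducible representations (there are as many of them as
   conjugacy classes), it follows that, for z not an integer, F_z^n generates H^n
   under translations and that its convolution with Theta_{n,z} is F_{z^*}^n.
   Hence convolution with Theta_{n,z} is compatible with the embeddings L_z and
   L_{z^*}.  It is isometric because the Gram matrices of the translates of F_z^n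
   and of F_{z^*}^n coincide, so it extends to the completions; uniqueness holds
   because the distinguished vector is cyclic. *)

Set Implicit Arguments.
Unset Strict Implicit.
Unset Printing Implicit Defensive.

Import Order.TTheory GRing.Theory Num.Theory.
Import numFieldNormedType.Exports.
Local Open Scope ring_scope.

(** * The sum of sgn(q) z^[qp] over row and column permutations *)

(** Common form of the row and column groups. Labels live on [nat], so that one function [r] serves
    both S(n) and S(n+1) in the induction on the last entry. *)
Definition stab_fun n (r : nat -> nat) : {set 'S_n} :=
  [set p : 'S_n | [forall k, r (p k) == r k]].

Lemma stab_funP n (r : nat -> nat) (p : 'S_n) :
  reflect (forall k, r (p k) = r k) (p \in stab_fun n r).
Proof. by rewrite inE; apply: (iffP forallP) => H k; apply/eqP. Qed.

Lemma group_set_stab_fun n (r : nat -> nat) : group_set (stab_fun n r).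
Proof.
apply/group_setP; split; first by apply/stab_funP=> k; rewrite perm1.
by move=> p q /stab_funP pr /stab_funP qr; apply/stab_funP=> k; rewrite permM qr pr.
Qed.

Canonical stab_fun_group n r := Group (group_set_stab_fun n r).

Lemma tperm_stab_fun n (r : nat -> nat) (i j : 'I_n) :
  r i = r j -> tperm i j \in stab_fun n r.
Proof. by move=> rij; apply/stab_funP=> k; case: tpermP => [->|->|]. Qed.

Lemma widen_stab_fun n (r : nat -> nat) (p : 'S_n) :
  (widen_perm p \in stab_fun n.+1 r) = (p \in stab_fun n r).
Proof.
apply/stab_funP/stab_funP=> H k.
  by have := H (lift ord_max k); rewrite lift_perm_lift !lift_max.
case: (unliftP ord_max k) => [j ->|->]; last by rewrite lift_perm_id.
by rewrite lift_perm_lift !lift_max.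
Qed.

Lemma widen_tperm n (i j : 'I_n) :
  widen_perm (tperm i j) = tperm (lift ord_max i) (lift ord_max j).
Proof.
apply/permP=> k; case: (unliftP ord_max k) => [l ->|->]; last first.
  by rewrite lift_perm_id tpermD // eq_sym neq_lift.
rewrite lift_perm_lift; case: (tpermP i j l) => [->|->|/eqP li /eqP lj].
- by rewrite tpermL.
- by rewrite tpermR.
by rewrite tpermD // (inj_eq lift_inj) eq_sym.
Qed.

Lemma proj_perm_tperm_widen n (i : 'I_n.+1) (p : 'S_n) :
  let x := (tperm ord_max i * widen_perm p)%g in
  proj_perm x = p /\ x^-1%g ord_max = i.
Proof.
move=> x; have E : x^-1%g ord_max = i.
  by rewrite invMg permM tpermV /widen_perm lift_permV lift_perm_id tpermL.
split=> //; apply: widen_perm_inj.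
by rewrite widen_proj_perm E mulgA tperm2 mul1g.
Qed.

(** Coset decomposition: x in S(n+1) is uniquely a transposition of the last point with i =
    x^-1(last) times an element of S(n). As x sends i to the last point, x can preserve labels only
    if these two labels agree. *)
Lemma big_stab_fun_recl (V : nmodType) n (r : nat -> nat) (F : 'S_n.+1 -> V) :
  \sum_(p in stab_fun n.+1 r) F p =
  \sum_(i < n.+1 | r i == r n)
     \sum_(p in stab_fun n r) F (tperm ord_max i * widen_perm p)%g.
Proof.
rewrite pair_big /=.
rewrite (reindex (fun u : 'I_n.+1 * 'S_n => (tperm ord_max u.1 * widen_perm u.2)%g)) /=.
  apply: eq_bigl => -[i p] /=; case: eqP => [ri|ri] /=.
    by rewrite groupMl ?widen_stab_fun // tperm_stab_fun //= ri.
  apply/stab_funP=> /(_ i); rewrite permM tpermR lift_perm_id /= => /esym.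
  exact: ri.
exists (fun x : 'S_n.+1 => (x^-1%g ord_max, proj_perm x)) => [[i p] _|x _] /=.
  by have [-> ->] := proj_perm_tperm_widen i p.
by rewrite widen_proj_perm mulgA tperm2 mul1g.
Qed.

Lemma big_stab_fun_recr (V : nmodType) n (r : nat -> nat) (F : 'S_n.+1 -> V) :
  \sum_(p in stab_fun n.+1 r) F p =
  \sum_(i < n.+1 | r i == r n)
     \sum_(p in stab_fun n r) F (widen_perm p * tperm ord_max i)%g.
Proof.
rewrite (reindex_inj invg_inj) /=.
under eq_bigl do rewrite groupV.
rewrite big_stab_fun_recl; apply: eq_bigr => i _.
rewrite (reindex_inj invg_inj) /=.
under eq_bigl do rewrite groupV.
by apply: eq_bigr => p _; rewrite invMg tpermV /widen_perm lift_permV invgK.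
Qed.

Lemma big_ord_lift_max (V : nmodType) n (P : pred 'I_n.+1) (F : 'I_n.+1 -> V) :
  P ord_max ->
  \sum_(i | P i) F i =
  F ord_max + \sum_(i | P (lift ord_max i)) F (lift ord_max i).
Proof.
move=> Pm; rewrite big_mkcond big_ord_recr /= Pm addrC; congr (_ + _).
rewrite [RHS]big_mkcond /=; apply: eq_bigr => i _.
have -> // : widen_ord (leqnSn n) i = lift ord_max i.
by apply: val_inj; rewrite /= /bump leqNgt ltn_ord.
Qed.

(** The middle factor [y] serves the recursion: removing the last entry can leave a transposition
    between [q] and [p]. *)
Definition row_col_sum (F : comRingType) (z : F) n (r c : nat -> nat) (y : 'S_n) : F :=
  \sum_(q in stab_fun n c) \sum_(p in stab_fun n r)
    (-1) ^+ q * z ^+ #|porbits (q * y * p)%g|.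

(* r m and c m are the row and the column of the entry m; for every m <= n the
   entries smaller than m fill a Young diagram. *)
Record tableau_like n (r c : nat -> nat) : Prop := TableauLike {
  tab_inj : forall i m, (i < m < n)%N -> r i = r m -> c i <> c m;
  tab_closed : forall i j m, (i < m < n)%N -> (j < m)%N ->
    r i = r m -> c j = c m -> exists k, [/\ (k < m)%N, r k = r j & c k = c i];
  tab_arm : forall m, (m < n)%N -> #|[pred i : 'I_m | r i == r m]| = c m;
  tab_leg : forall m, (m < n)%N -> #|[pred j : 'I_m | c j == c m]| = r m }.

Lemma tableau_likeW n r c : tableau_like n.+1 r c -> tableau_like n r c.
Proof.
case=> h1 h2 h3 h4; split=> [i m /andP[im mn]|i j m /andP[im mn]|m mn|m mn].
- by apply: h1; rewrite im ltnW.
- by apply: h2; rewrite im ltnW.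
- by apply: h3; rewrite ltnW.
- by apply: h4; rewrite ltnW.
Qed.

(* With k the fourth corner of the rectangle spanned by i, j and n, the
   substitution p -> (k j) p turns q (j i) p into q (k i) (j i) p, and (k i) is
   an odd element of the column group. *)
Lemma row_col_sum_tperm0 (F : numDomainType) (z : F) n r c (i j : 'I_n) :
  tableau_like n.+1 r c -> r i = r n -> c j = c n ->
  row_col_sum z r c (tperm j i) = 0.
Proof.
move=> tab ri cj.
have [//||k [kn rk ck]] := tab_closed tab _ _ ri cj.
- by rewrite ltn_ord /=.
- exact: ltn_ord.
pose k' := Ordinal kn.
have ki : k' != i.
  apply/eqP=> E; apply: (tab_inj tab (i := j) (m := n)) => //.
    by rewrite ltn_ord /=.
  by rewrite -rk -ri -E.
have kj : k' != j.
  apply/eqP=> E; apply: (tab_inj tab (i := i) (m := n)) => //.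
    by rewrite ltn_ord /=.
  by rewrite -ck -cj -E.
have [ij|ij] := eqVneq i j.
  exfalso; apply: (tab_inj tab (i := i) (m := n)) => //.
    by rewrite ltn_ord /=.
  by rewrite -cj ij.
suff E : row_col_sum z r c (tperm j i) = - row_col_sum z r c (tperm j i).
  apply/eqP; move/eqP: E; rewrite -subr_eq0 opprK -mulr2n mulrn_eq0.
  by case/orP.
rewrite {1}/row_col_sum.
under eq_bigr => q _.
  rewrite (reindex_inj (mulgI (tperm k' j))) /=.
  under eq_bigl => p do rewrite groupMl ?(tperm_stab_fun (r := r) (i := k')) //=.
  over.
rewrite /row_col_sum -sumrN (reindex_inj (mulIg (tperm k' i))) /=.
apply: eq_big => [q|q _]; first by rewrite groupMr ?(tperm_stab_fun (r := c) (i := k')).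
rewrite -sumrN; apply: eq_bigr => p _.
have -> : (q * tperm k' i * tperm j i * (tperm k' j * p) = q * tperm j i * p)%g.
  rewrite !mulgA; congr (_ * _)%g; rewrite -!mulgA; congr (_ * _)%g.
  have -> : tperm k' i = (tperm k' j ^ tperm j i)%g.
    by rewrite tpermJ tpermL tpermD // eq_sym // ij.
  by rewrite conjgE tpermV -!mulgA [(tperm j i * (tperm j i * _))%g]mulgA tperm2 mul1g tperm2 mulg1.
by rewrite odd_permM odd_tperm ki addbT signrN mulNr.
Qed.

(** Induction on the last entry n. Write q = q'(n j) and p = (n i)p' with q', p' in S(n). In units
    of the sum over S(n), the pair i = j = n contributes z, each i < n in the row of n (with j = n)
    contributes 1, each j < n in its column (with i = n) contributes -1, and the remaining pairs
    contribute 0. The arm and leg counts give the new factor. *)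
Lemma row_col_sumE (F : numDomainType) (z : F) n r c :
  tableau_like n r c ->
  row_col_sum z r c (1 : 'S_n)%g =
  \prod_(m < n) (z + (c m)%:R - (r m)%:R).
Proof.
elim: n => [|n IH] tab.
  have u (p : 'S_0) : p = 1%g by apply/permP; case.
  rewrite big_ord0 /row_col_sum (big_pred1 1%g) => [|q]; last first.
    by rewrite (u q) group1 /= eqxx.
  rewrite (big_pred1 1%g) => [|q]; last by rewrite (u q) group1 /= eqxx.
  rewrite odd_perm1 mul1r eq_card0 ?expr0 // => A.
  by apply/imsetP=> -[[]].
rewrite big_ord_recr /= -IH; last exact: tableau_likeW.
rewrite {1}/row_col_sum big_stab_fun_recr.
under eq_bigr => j _ do under eq_bigr => q _ do rewrite big_stab_fun_recl.
pose G (j i : 'I_n.+1) := (tperm ord_max j * tperm ord_max i)%g : 'S_n.+1.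
have ACA (a b u v : F) : a * b * (u * v) = b * v * (a * u) by ring.
(* The sign is that of (n j); the extra factor z appears exactly when [G j i] fixes n, which is then
   a cycle by itself. *)
pose K (j i : 'I_n.+1) := (-1) ^+ (j != ord_max) * z ^+ in_subgroup (G j i) *
   row_col_sum z r c (proj_perm (G j i)).
transitivity (\sum_(j < n.+1 | c j == c n) \sum_(i < n.+1 | r i == r n) K j i).
  apply: eq_bigr => j _; rewrite exchange_big; apply: eq_bigr => i _.
  rewrite /K /row_col_sum mulr_sumr; apply: eq_bigr => q _.
  rewrite mulr_sumr; apply: eq_bigr => p _.
  rewrite mulg1 card_porbits_proj.
  have -> : (widen_perm q * tperm ord_max j * (tperm ord_max i * widen_perm p) =
    widen_perm q * G j i * widen_perm p)%g by rewrite /G !mulgA.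
  rewrite proj_permM in_subgroupM odd_permM odd_tperm.
  rewrite /widen_perm odd_lift_perm addbb addFb signr_addb exprD eq_sym.
  exact: ACA.
have Kmm : K ord_max ord_max = z * row_col_sum z r c (1 : 'S_n)%g.
  rewrite /K /G tperm1 mulg1 eqxx /= mul1r.
  rewrite /in_subgroup perm1 eqxx expr1; congr (_ * row_col_sum _ _ _ _).
  apply: widen_perm_inj; rewrite widen_proj_permE perm1 tperm1 mulg1.
  by rewrite /widen_perm lift_perm1.
have Nm (k : 'I_n) : lift ord_max k != ord_max by rewrite eq_sym neq_lift.
have KmN i : K ord_max (lift ord_max i) = row_col_sum z r c (1 : 'S_n)%g.
  rewrite /K /G tperm1 mul1g eqxx /= mul1r /in_subgroup tpermL (negPf (Nm i)) mul1r.
  congr row_col_sum; apply: widen_perm_inj.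
  by rewrite widen_proj_permE tpermL tpermC tperm2 /widen_perm lift_perm1.
have KNm j : K (lift ord_max j) ord_max = - row_col_sum z r c (1 : 'S_n)%g.
  rewrite /K /G tperm1 mulg1 Nm mulN1r mulNr /in_subgroup tpermL (negPf (Nm j)) mul1r.
  congr (- row_col_sum _ _ _ _); apply: widen_perm_inj.
  by rewrite widen_proj_permE tpermL tpermC tperm2 /widen_perm lift_perm1.
(* Removing n from its cycle in (n j)(n i) leaves (j i), whose sum vanishes. *)
have KNN (i j : 'I_n) : r i = r n -> c j = c n -> K (lift ord_max j) (lift ord_max i) = 0.
  move=> ri cj.
  have ij : i != j.
    apply/eqP=> ij; apply: (tab_inj tab (i := i) (m := n)) => //.
      by rewrite ltn_ord /=.
    by rewrite ij.
  rewrite /K; suff -> : proj_perm (G (lift ord_max j) (lift ord_max i)) = tperm j i.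
    by rewrite row_col_sum_tperm0 // mulr0.
  apply: widen_perm_inj; rewrite widen_proj_permE /G permM tpermL.
  rewrite tpermD ?neq_lift ?(inj_eq lift_inj) //.
  transitivity (tperm ord_max (lift ord_max i) ^ tperm ord_max (lift ord_max j))%g.
    by rewrite conjgE tpermV mulgA [tperm (lift _ _) ord_max]tpermC.
  rewrite tpermJ tpermL tpermD ?neq_lift // ?(inj_eq lift_inj) 1?eq_sym //.
  by rewrite widen_tperm.
clearbody K.
have bumpE (k : 'I_n) : bump n k = k by rewrite /bump leqNgt ltn_ord.
rewrite big_ord_lift_max //= big_ord_lift_max //= Kmm.
under eq_bigr => i _ do rewrite KmN.
under [X in _ + X]eq_bigr => j cj.
  rewrite big_ord_lift_max //= KNm big1 => [|i ri]; last first.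
    by apply: KNN; [move: ri|move: cj]; rewrite /= bumpE => /eqP.
  rewrite addr0; over.
rewrite !sumr_const.
have -> : #|[pred i : 'I_n | r (lift ord_max i) == r n]| = c n.
  by rewrite -(tab_arm tab (ltnSn n)); apply: eq_card => i; rewrite !inE /= bumpE.
have -> : #|[pred i : 'I_n | c (lift ord_max i) == c n]| = r n.
  by rewrite -(tab_leg tab (ltnSn n)); apply: eq_card => i; rewrite !inE /= bumpE.
by rewrite mulNrn -[_ *+ c n]mulr_natr -[_ *+ r n]mulr_natr; ring.
Qed.

(** * Tableaux filled row by row *)

Section ReshapeTableau.
Variables (sh : seq nat).
Hypothesis sh_sorted : sorted geq sh.
Let r := reshape_index sh.
Let c := reshape_offset sh.

Lemma reshape_ltn i1 i2 :
  (i1 < i2)%N = ((r i1 < r i2) || ((r i1 == r i2) && (c i1 < c i2)))%N.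
Proof.
rewrite ltnNge (reshape_leq sh i2 i1) -/(r _) -/(r _) -/(c _) -/(c _).
by lia.
Qed.

Lemma nth_sorted_geq i j : (i <= j)%N -> (nth 0 sh j <= nth 0 sh i)%N.
Proof.
move=> ij; case: (ltnP j (size sh)) => [js|js]; last by rewrite nth_default.
have gt : transitive geq by move=> x y z /= h1 h2; apply: leq_trans h2 h1.
by apply: (sorted_leq_nth gt leqnn 0 sh_sorted); rewrite ?inE // (leq_ltn_trans ij).
Qed.

Lemma reshape_inj i j : r i = r j -> c i = c j -> i = j.
Proof. by move=> rij cij; rewrite -(reshape_indexK sh i) -/(r _) -/(c _) rij cij reshape_indexK. Qed.

(** Entries increase in the lexicographic order of (row, column). The fourth corner is the box (r j,
    c i), which exists because the higher row r j is at least as long as row r i. The arm of m is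
    indexed by the columns before c m, its leg by the rows above r m. *)
Lemma reshape_tableau_like : tableau_like (sumn sh) r c.
Proof.
have box m : (m < sumn sh)%N -> (c m < nth 0 sh (r m))%N by exact: reshape_offsetP.
have fK i j : (j < nth 0 sh i)%N ->
    r (flatten_index sh i j) = i /\ c (flatten_index sh i j) = j.
  by move=> h; rewrite /r /c flatten_indexKl ?flatten_indexKr.
split=> [i m /andP[im _] rim cim|i j m /andP[im mn] jm rim cjm|m mn|m mn].
- by move: im; rewrite (reshape_inj rim cim) ltnn.
- have b : (c i < nth 0 sh (r j))%N.
    have := jm; rewrite reshape_ltn cjm ltnn andbF orbF => /ltnW/nth_sorted_geq.
    by apply: leq_trans; rewrite -rim box // (ltn_trans im).
  have [rk ck] := fK _ _ b; exists (flatten_index sh (r j) (c i)); split=> //.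
  have := jm; rewrite [(j < m)%N]reshape_ltn cjm ltnn andbF orbF => h.
  by rewrite reshape_ltn rk h.
- have b (j : 'I_(c m)) := ltn_trans (ltn_ord j) (box _ mn).
  have lt (j : 'I_(c m)) : (flatten_index sh (r m) j < m)%N.
    by rewrite reshape_ltn (fK _ _ (b j)).1 (fK _ _ (b j)).2 eqxx ltn_ord orbT.
  rewrite -[RHS]card_ord -(card_imset predT (f := fun j => Ordinal (lt j))); last first.
    move=> j j' /(congr1 (c \o val)) /=.
    by rewrite (fK _ _ (b j)).2 (fK _ _ (b j')).2 => /val_inj.
  apply: eq_card => i; rewrite !inE; apply/eqP/imsetP => [ri|[j _ ->]]; last first.
    by rewrite /= (fK _ _ (b j)).1.
  have ci : (c i < c m)%N by have := ltn_ord i; rewrite reshape_ltn ri ltnn eqxx.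
  exists (Ordinal ci) => //; apply/val_inj/reshape_inj => /=.
    by rewrite (fK _ _ (b (Ordinal ci))).1.
  by rewrite (fK _ _ (b (Ordinal ci))).2.
- have b (i : 'I_(r m)) : (c m < nth 0 sh i)%N.
    by apply: leq_trans (box _ mn) (nth_sorted_geq _); exact: ltnW.
  have lt (i : 'I_(r m)) : (flatten_index sh i (c m) < m)%N.
    by rewrite reshape_ltn (fK _ _ (b i)).1 ltn_ord.
  rewrite -[RHS]card_ord -(card_imset predT (f := fun j => Ordinal (lt j))); last first.
    move=> j j' /(congr1 (r \o val)) /=.
    by rewrite (fK _ _ (b j)).1 (fK _ _ (b j')).1 => /val_inj.
  apply: eq_card => i; rewrite !inE; apply/eqP/imsetP => [ci|[j _ ->]]; last first.
    by rewrite /= (fK _ _ (b j)).2.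
  have ri : (r i < r m)%N by have := ltn_ord i; rewrite reshape_ltn ci ltnn andbF orbF.
  exists (Ordinal ri) => //; apply/val_inj/reshape_inj => /=.
    by rewrite (fK _ _ (b (Ordinal ri))).1.
  by rewrite (fK _ _ (b (Ordinal ri))).2.
Qed.

End ReshapeTableau.

Section YoungRows.
Variables (n : nat) (la : young n).

Lemma sorted_rows : sorted geq (rows la).
Proof. by have /andP[] := valP la. Qed.

Lemma sumn_rows : sumn (rows la) = n.
Proof. by have /andP[_ /eqP] := valP la. Qed.

Lemma size_rows : size (rows la) = n.
Proof. by rewrite size_map size_tuple. Qed.

Lemma tableau_like_young :
  tableau_like n (reshape_index (rows la)) (reshape_offset (rows la)).
Proof. by have := reshape_tableau_like sorted_rows; rewrite sumn_rows. Qed.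

Lemma tableau_box (k : 'I_n) : (tableau_col la k < nth 0 (rows la) (tableau_row la k))%N.
Proof. by apply: reshape_offsetP; rewrite sumn_rows. Qed.

Lemma tableau_boxK i j : (j < nth 0 (rows la) i)%N ->
  exists k : 'I_n, tableau_row la k = i /\ tableau_col la k = j.
Proof.
move=> h; have lt := flatten_indexP h; rewrite sumn_rows in lt.
by exists (Ordinal lt); rewrite /tableau_row /tableau_col /= flatten_indexKl ?flatten_indexKr.
Qed.

Lemma tableau_row_lt (k : 'I_n) : (tableau_row la k < n)%N.
Proof. by rewrite -{2}size_rows; apply: reshape_indexP; rewrite sumn_rows. Qed.

Lemma tableau_col_lt (k : 'I_n) : (tableau_col la k < n)%N.
Proof.
apply: leq_trans (tableau_box k) _.
by rewrite (nth_map ord0) ?size_tuple ?tableau_row_lt // -ltnS ltn_ord.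
Qed.

Lemma tableau_inj (k l : 'I_n) :
  tableau_row la k = tableau_row la l -> tableau_col la k = tableau_col la l -> k = l.
Proof. by move=> h1 h2; apply/val_inj/(reshape_inj (sh := rows la)). Qed.

Lemma prod_content (F : comNzRingType) (f : int -> F) :
  \prod_(b : 'I_n * 'I_n | in_diagram la b) f (content b) =
  \prod_(k < n) f ((tableau_col la k)%:Z - (tableau_row la k)%:Z).
Proof.
rewrite (reindex (fun k : 'I_n => (Ordinal (tableau_row_lt k), Ordinal (tableau_col_lt k)))).
  by apply: eq_bigl => k; rewrite /in_diagram /= tableau_box.
(* The implication makes the inverse of the reindexing total; outside the diagram its value is a
   dummy. *)
have h (b : 'I_n * 'I_n) : exists k : 'I_n, in_diagram la b ==>
    ((tableau_row la k == b.1) && (tableau_col la k == b.2)).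
  case: (boolP (in_diagram la b)) => [/tableau_boxK[k [h1 h2]]|_].
    by exists k; rewrite h1 h2 !eqxx.
  by exists b.1.
exists (fun b => xchoose (h b)) => [k _|b bin].
  pose b := (Ordinal (tableau_row_lt k), Ordinal (tableau_col_lt k)).
  by case/andP: (implyP (xchooseP (h b)) (tableau_box k)) => /eqP h1 /eqP h2; apply: tableau_inj.
have /implyP := xchooseP (h b); rewrite -topredE /= in bin; move=> /(_ bin)/andP[/eqP h1 /eqP h2].
by case: b h1 h2 {bin} => b1 b2 /= h1 h2; congr pair; apply: val_inj.
Qed.

End YoungRows.

(** * Permutations separating the rows *)

(** The dichotomy behind Young symmetrizers: if this fails, a transposition makes a product of
    symmetrizers vanish; if it holds, la does not exceed mu lexicographically, and for la = mu the
    permutation factors. *)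
Definition separates_rows n (la mu : young n) (x : 'S_n) : Prop :=
  forall a b : 'I_n, tableau_row la a = tableau_row la b ->
    tableau_col mu (x a) = tableau_col mu (x b) -> a = b.

Section SeparatesRows.
Variables (n : nat) (la mu : young n) (x : 'S_n) (k0 : nat).
Hypothesis eq_rows : forall i, (i < k0)%N -> nth 0 (rows la) i = nth 0 (rows mu) i.
Hypothesis sep : separates_rows la mu x.

(* Otherwise column [tableau_col mu (x b)] of mu would receive, besides b, one
   entry from each of the rows of la which are long enough to reach it. *)
Lemma separates_rows_col_lt (b : 'I_n) : (tableau_row la b <= k0)%N ->
  (tableau_col mu (x b) < nth 0 (rows mu) (tableau_row la b))%N.
Proof.
have [k] := ubnP (tableau_row la b); elim: k b => // k IH b bk bk0.
rewrite ltnNge; apply/negP => jb; set j := tableau_col mu (x b) in jb.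
(* By induction x maps row i of la injectively into the columns that row i of mu reaches; the two
   rows have the same length, so column j is hit. *)
have onto (d : 'I_n) : tableau_col mu d = j ->
    exists e : 'I_n, tableau_row la e = tableau_row mu d /\ tableau_col mu (x e) = j.
  move=> dj; have := tableau_box mu d; rewrite dj; set i := tableau_row mu d => ji.
  have ib : (i < tableau_row la b)%N.
    rewrite ltnNge; apply/negP=> /(nth_sorted_geq (sorted_rows mu)) h.
    by have := leq_trans ji (leq_trans h jb); rewrite ltnn.
  have [u uP] := fin_all_exists (fun c : 'I_(nth 0 (rows mu) i) =>
     tableau_boxK (la := la) (i := i) (j := c)
       (eq_ind_r (fun m => (c < m)%N) (ltn_ord c) (eq_rows (leq_trans ib bk0)))).
  have lt c : (tableau_col mu (x (u c)) < nth 0 (rows mu) i)%N.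
    by rewrite -(uP c).1; apply: IH; rewrite (uP c).1 ?(leq_trans ib) // ltnW // (leq_trans ib).
  have inj : injective (fun c => Ordinal (lt c)).
    move=> c c' /(congr1 val) /= E; apply: val_inj; rewrite /= -(uP c).2 -(uP c').2.
    by congr tableau_col; apply: sep => //; rewrite (uP c).1 (uP c').1.
  have [g _ gK] := injF_bij inj.
  exists (u (g (Ordinal ji))); split; first by rewrite (uP _).1.
  by have /(congr1 val) := gK (Ordinal ji).
(* Double count: [onto] gives at least as many elements in [E] as in [D], while [x] injects [E]
   together with the further entry [b] into [D]. *)
pose D := [set d : 'I_n | tableau_col mu d == j].
pose E := [set e : 'I_n | (tableau_col mu (x e) == j) && (tableau_row la e < tableau_row la b)%N].
have leD : (#|D| <= #|E|)%N.
  have onto' (d : 'I_n) : exists e : 'I_n, (tableau_col mu d == j) ==>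
     ((tableau_row la e == tableau_row mu d) && (tableau_col mu (x e) == j)).
    case: eqP => [/onto[e [h1 h2]]|_]; last by exists b.
    by exists e; rewrite h1 h2 !eqxx.
  pose f d := xchoose (onto' d).
  have fP d : d \in D -> tableau_row la (f d) = tableau_row mu d /\ tableau_col mu (x (f d)) = j.
    rewrite inE => dD; have /implyP := xchooseP (onto' d).
    by case/(_ dD)/andP=> /eqP h1 /eqP h2.
  rewrite -(card_in_imset (f := f) (D := D)).
    apply: subset_leq_card; apply/fintype.subsetP => _ /imsetP[d dD ->]; rewrite inE.
    have [h1 h2] := fP d dD; rewrite h1 h2 eqxx /=.
    move: dD; rewrite inE => /eqP dj.
    rewrite ltnNge; apply/negP=> /(nth_sorted_geq (sorted_rows mu)) h.
    have := tableau_box mu d; rewrite dj => ji.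
    by have := leq_trans ji (leq_trans h jb); rewrite ltnn.
  move=> d d' dD d'D E0; apply: (@tableau_inj _ mu).
    by rewrite -(fP d dD).1 -(fP d' d'D).1 E0.
  by move: dD d'D; rewrite !inE => /eqP -> /eqP ->.
have : (#|b |: E| <= #|D|)%N.
  rewrite -(card_imset (b |: E) (@perm_inj _ x)).
  apply: subset_leq_card; apply/fintype.subsetP => _ /imsetP[e eE ->]; rewrite inE.
  by move: eE; rewrite !inE => /orP[/eqP -> //|/andP[]].
rewrite cardsU1 inE ltnn andbF /= => h.
by have := leq_trans h leD; rewrite add1n ltnn.
Qed.

(** The entries of row [k0] of la go to distinct columns of mu, all within row [k0] by the preceding
    bound. *)
Lemma separates_rows_leq : (nth 0 (rows la) k0 <= nth 0 (rows mu) k0)%N.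
Proof.
have [u uP] := fin_all_exists (fun c : 'I_(nth 0 (rows la) k0) =>
     tableau_boxK (la := la) (i := k0) (j := c) (ltn_ord c)).
have lt c : (tableau_col mu (x (u c)) < nth 0 (rows mu) k0)%N.
  by rewrite -(uP c).1; apply: separates_rows_col_lt; rewrite (uP c).1.
have inj : injective (fun c => Ordinal (lt c)).
  move=> c c' /(congr1 val) /= E; apply: val_inj; rewrite /= -(uP c).2 -(uP c').2.
  by congr tableau_col; apply: sep => //; rewrite (uP c).1 (uP c').1.
by have := leq_card _ inj; rewrite !card_ord.
Qed.

End SeparatesRows.

(** The box in the row of b and the column of x b lies in the diagram. Moving each b to the entry of
    that box is the row permutation p, and p^-1 x then preserves columns. *)
Lemma separates_rows_factor n (la : young n) (x : 'S_n) :
  separates_rows la la x ->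
  exists p q, [/\ p \in row_group la, q \in col_group la & x = (p * q)%g].
Proof.
move=> sep.
have box (b : 'I_n) : (tableau_col la (x b) < nth 0 (rows la) (tableau_row la b))%N.
  by apply: (separates_rows_col_lt (k0 := n)) => //; apply/ltnW/tableau_row_lt.
have [u uP] := fin_all_exists (fun b : 'I_n => tableau_boxK (box b)).
have inj : injective u.
  move=> a b ab; apply: sep.
    by rewrite -(uP a).1 -(uP b).1 ab.
  by rewrite -(uP a).2 -(uP b).2 ab.
exists (perm inj), ((perm inj)^-1 * x)%g; split; last by rewrite mulKVg.
  by apply/stab_funP=> k; rewrite permE; exact: (uP k).1.
apply/stab_funP=> k; rewrite permM; set l := ((perm inj)^-1)%g k.
have -> : k = perm inj l by rewrite permKV.
by rewrite permE; exact: esym (uP l).2.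
Qed.

Definition lex_gt n (la mu : young n) : Prop :=
  exists k, (forall i, (i < k)%N -> nth 0 (rows la) i = nth 0 (rows mu) i) /\
    (nth 0 (rows mu) k < nth 0 (rows la) k)%N.

Lemma lex_gt_total n (la mu : young n) : la <> mu -> lex_gt la mu \/ lex_gt mu la.
Proof.
move=> ne; have ex : exists k, nth 0 (rows la) k != nth 0 (rows mu) k.
  apply: contrapT => /forallNP h; apply: ne; apply/val_inj/val_inj.
  apply: (inj_map val_inj); apply: (@eq_from_nth _ 0%N); first by rewrite !size_rows.
  by move=> i _; have /negP/negPn/eqP := h i.
have [k kP kmin] := ex_minnP ex.
have eqk i : (i < k)%N -> nth 0 (rows la) i = nth 0 (rows mu) i.
  by move=> ik; apply/eqP/negPn/negP => /kmin; rewrite leqNgt ik.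
move: kP; rewrite neq_ltn => /orP[lt|lt]; [right|left]; exists k; split=> // i ik.
by rewrite eqk.
Qed.

Lemma lex_gt_not_separates n (la mu : young n) (x : 'S_n) :
  lex_gt la mu -> exists a b : 'I_n, [/\ a != b, tableau_row la a = tableau_row la b
     & tableau_col mu (x a) = tableau_col mu (x b)].
Proof.
case=> k [eqk ltk]; apply: contrapT => /forallNP h.
suff /(separates_rows_leq eqk) : separates_rows la mu x by rewrite leqNgt ltk.
move=> a b rab cab; apply/eqP/negPn/negP => ab; have /forallNP := h a.
by move/(_ b); apply.
Qed.

(** * Specht modules *)

Lemma card_porbitsJ n (x y : 'S_n) : #|porbits (x ^ y)%g| = #|porbits x|.
Proof.
have porbitJ i : porbit (x ^ y) (y i) = [set y j | j in porbit x i].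
  apply/setP=> k; apply/porbitP/imsetP => [[m ->]|[_ /porbitP[m ->] ->]].
    exists ((x ^+ m)%g i); first exact: mem_porbit.
    by rewrite -conjXg conjgE !permM permK.
  by exists m; rewrite -conjXg conjgE !permM permK.
rewrite -(card_imset (porbits x) (imset_inj (@perm_inj _ y))).
congr #|pred_of_set _|; apply/setP=> A; apply/imsetP/imsetP => [[i _ ->]|[_ /imsetP[i _ ->] ->]].
  exists (porbit x ((y^-1)%g i)); first exact: imset_f.
  by rewrite -porbitJ permKV.
by exists (y i); rewrite ?porbitJ.
Qed.

Lemma group_set_row_group n (la : young n) : group_set (row_group la).
Proof. exact: group_set_stab_fun. Qed.
Canonical row_group_group n (la : young n) := Group (group_set_row_group la).

Lemma group_set_col_group n (la : young n) : group_set (col_group la).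
Proof. exact: group_set_stab_fun. Qed.
Canonical col_group_group n (la : young n) := Group (group_set_col_group la).

Section SpechtRepr.
Variables (R : realType) (n : nat).
Local Notation C := R[i].
Local Notation G := [set: 'S_n]%G.
Local Notation U := (regular_repr C G).
Implicit Types (la mu : young n).

Definition row_sum la : 'M[C]_#|G| := \sum_(p in row_group la) U p.
Definition col_sum la : 'M[C]_#|G| := \sum_(q in col_group la) (-1) ^+ q *: U q.

Local Notation A := row_sum.
Local Notation B := col_sum.

Lemma regularM (x y : 'S_n) : U (x * y)%g = U x *m U y.
Proof. by rewrite repr_mxM ?inE. Qed.

Lemma row_sumMl la p : p \in row_group la -> U p *m A la = A la.
Proof.
move=> pP; rewrite mulmx_sumr [RHS](reindex_inj (mulgI p)) /=.
apply: eq_big => [q|q _]; first by rewrite groupMl.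
by rewrite -regularM.
Qed.

Lemma row_sumMr la p : p \in row_group la -> A la *m U p = A la.
Proof.
move=> pP; rewrite mulmx_suml [RHS](reindex_inj (mulIg p)) /=.
apply: eq_big => [q|q _]; first by rewrite groupMr.
by rewrite -regularM.
Qed.

Lemma col_sumMr la q : q \in col_group la -> B la *m U q = (-1) ^+ q *: B la.
Proof.
move=> qQ; rewrite mulmx_suml scaler_sumr [RHS](reindex_inj (mulIg q)) /=.
apply: eq_big => [p|p _]; first by rewrite groupMr.
by rewrite -scalemxAl -regularM scalerA odd_permM signr_addb mulrCA -expr2 sqrr_sign mulr1.
Qed.

Lemma row_sum_sqr la : A la *m A la = #|row_group la|%:R *: A la.
Proof.
rewrite {2}/row_sum mulmx_sumr; under eq_bigr => p pP do rewrite row_sumMr //.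
by rewrite sumr_const scaler_nat.
Qed.

(* U x A = U x (a b) A = (x^-1 a, x^-1 b) U x A, and this transposition is odd
   in the column group of mu. *)
Lemma col_row_sum0 la mu (x : 'S_n) (a b : 'I_n) :
  a != b -> tableau_row la a = tableau_row la b ->
  tableau_col mu ((x^-1)%g a) = tableau_col mu ((x^-1)%g b) ->
  B mu *m U x *m A la = 0.
Proof.
move=> ab rab cab.
suff E : B mu *m U x *m A la = - (B mu *m U x *m A la).
  apply/eqP; move/eqP: E; rewrite -subr_eq0 opprK -mulr2n -scaler_nat scaler_eq0.
  by rewrite pnatr_eq0.
have tP : tperm a b \in row_group la by apply: (tperm_stab_fun (r := reshape_index (rows la))).
have tQ : tperm (x^-1 a)%g (x^-1 b)%g \in col_group mu.
  exact: (tperm_stab_fun (r := reshape_offset (rows mu))).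
rewrite -{1}(row_sumMl tP) mulmxA -[B mu *m _ *m _]mulmxA -regularM.
have -> : (x * tperm a b)%g = (tperm (x^-1 a) (x^-1 b) * x)%g.
  by rewrite -tpermJ conjgE invgK -!mulgA mulVg mulg1.
by rewrite regularM mulmxA col_sumMr // odd_tperm (inj_eq perm_inj) ab expr1 scaleN1r !mulNmx.
Qed.

Lemma lex_gt_col_row_sum la mu (x : 'S_n) : lex_gt la mu -> B mu *m U x *m A la = 0.
Proof.
by move/(lex_gt_not_separates x^-1) => [a [b [ab rab cab]]]; apply: col_row_sum0 ab rab cab.
Qed.

Lemma col_row_sum_fact la (q p : 'S_n) : q \in col_group la -> p \in row_group la ->
  B la *m U (q * p)%g *m A la = (-1) ^+ q *: (B la *m A la).
Proof.
by move=> qQ pP; rewrite regularM mulmxA col_sumMr // -mulmxA row_sumMl // scalemxAl.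
Qed.

(** If the inverse of [x] separates rows, it factors, and inverting puts the column factor first;
    otherwise a transposition kills the product. *)
Lemma col_row_sum_cases la (x : 'S_n) : B la *m U x *m A la = 0 \/
  exists q p, [/\ q \in col_group la, p \in row_group la & x = (q * p)%g].
Proof.
have [sep|] := pselect (separates_rows la la (x^-1)%g).
  right; have [p [q [pP qQ E]]] := separates_rows_factor sep.
  exists (q^-1)%g, (p^-1)%g; split.
  - by rewrite groupV.
  - by rewrite groupV.
  by rewrite -invMg -E invgK.
move=> nsep; left; apply: contrapT => BA; apply: nsep => a b rab cab.
by apply/eqP/negPn/negP => ab; apply: BA; apply: col_row_sum0 ab rab cab.
Qed.

(** Each [U x] contributes 0 or a sign times [B la *m A la]. This one-dimensionality is the source
    of the simplicity of the Specht module. *)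
Lemma col_row_sum_line la X : (X \in group_ring C G)%MS ->
  exists k : C, B la *m X *m A la = k *: (B la *m A la).
Proof.
case/envelop_mxP=> a ->.
have ex (x : 'S_n) : exists k : C, B la *m U x *m A la = k *: (B la *m A la).
  case: (col_row_sum_cases la x) => [->|[q [p [qQ pP ->]]]].
    by exists 0; rewrite scale0r.
  by exists ((-1) ^+ q); apply: col_row_sum_fact.
have [k kP] := choice ex.
exists (\sum_(x in G) a x * k x).
rewrite [B la *m _]mulmx_sumr mulmx_suml scaler_suml; apply: eq_bigr => x _.
by rewrite -scalemxAr -scalemxAl kP scalerA.
Qed.

(** [p \p q] unfolds to [q * p], which puts the column sum on the left. *)
Lemma young_symmetrizerE la : young_symmetrizer R la = gring_row (B la *m A la).
Proof.
rewrite /young_symmetrizer exchange_big mulmx_suml linear_sum; apply: eq_bigr => q _.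
rewrite mulmx_sumr linear_sum; apply: eq_bigr => p _.
by rewrite -scalemxAl linearZ /= -regularM.
Qed.

Lemma row_col_group_id la q : q \in row_group la -> q \in col_group la -> q = 1%g.
Proof.
move=> /stab_funP h1 /stab_funP h2; apply/permP=> k; rewrite perm1.
exact: (tableau_inj (h1 k) (h2 k)).
Qed.

(** Its coefficient at the identity is 1: the row and column groups meet trivially, so [q * p = 1]
    forces both factors to be trivial. *)
Lemma young_symmetrizer_neq0 la : young_symmetrizer R la != 0.
Proof.
apply/eqP=> /(congr1 (fun v : 'rV[C]_#|G| => v 0 (gring_index G 1%g))); rewrite mxE.
have E (q p : 'S_n) : gring_row (((-1) ^+ q *: U q) *m U p) 0 (gring_index G 1%g) =
    (-1) ^+ q * (q * p == 1)%g%:R.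
  rewrite -scalemxAl -regularM linearZ /= mxE; congr (_ * _).
  rewrite /gring_row !mxE gring_indexK ?inE // mul1g eqxx /=.
  by rewrite eq_sym (can_in_eq (gring_indexK (G := G))) ?inE.
have -> : young_symmetrizer R la 0 (gring_index G 1%g) =
    \sum_(q in col_group la) \sum_(p in row_group la) (-1) ^+ q * (q * p == 1)%g%:R.
  rewrite young_symmetrizerE mulmx_suml linear_sum summxE; apply: eq_bigr => q _.
  by rewrite mulmx_sumr linear_sum summxE; apply: eq_bigr => p _; apply: E.
rewrite (bigD1 1%g) ?group1 //=.
rewrite (bigD1 1%g) ?group1 //= mulg1 eqxx odd_perm1 mulr1.
rewrite big1 ?addr0; last by move=> p /andP[_ /negPf p1]; rewrite mul1g p1 mulr0.
rewrite big1 ?addr0; first by move/eqP; rewrite expr0 oner_eq0.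
move=> q /andP[qQ q1]; rewrite big1 // => p pP.
case: eqP => [qp|_]; last by rewrite mulr0.
case/eqP: q1; apply: (row_col_group_id _ qQ).
by rewrite (canRL (mulgK p) qp) mul1g groupV.
Qed.

End SpechtRepr.

Lemma mx_rsim_sum0 (F : fieldType) (gT : finGroupType) (G : {group gT}) n1 n2
    (r1 : mx_representation F G n1) (r2 : mx_representation F G n2) (D : {set gT}) :
  mx_rsim r1 r2 -> D \subset G ->
  \sum_(x in D) r2 x = 0 -> \sum_(x in D) r1 x = 0.
Proof.
move=> [f _ injf homf] /fintype.subsetP DG r20; apply: (row_free_inj injf).
rewrite mul0mx mulmx_suml -[RHS](mulmx0 _ f) -r20 mulmx_sumr.
by apply: eq_bigr => x /DG/homf.
Qed.

(** * Simplicity and inequivalence of Specht modules; the scalar of the cycle sum *)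

Section SpechtIrreducible.
Variables (R : realType) (n : nat).
Local Notation C := R[i].
Local Notation G := [set: 'S_n]%G.
Local Notation U := (regular_repr C G).
Local Notation A := (@row_sum R n).
Local Notation B := (@col_sum R n).
Local Notation ys := (@young_symmetrizer R n).
Implicit Types (la mu : young n).

Lemma row_sum_in_ring la : (A la \in group_ring C G)%MS.
Proof.
apply/envelop_mxP; exists (fun p => (p \in row_group la)%:R).
rewrite /row_sum big_mkcond; apply: eq_big => [p|p _]; first by rewrite inE.
by case: ifP; rewrite ?scale1r ?scale0r.
Qed.

Lemma pchar_sym : ([pchar C]^').-group%g [set: 'S_n].
Proof. by apply/pgroupP=> p pr_p _; rewrite inE /= pchar_num. Qed.

Lemma young_symmetrizer_row_sum la : ys la *m A la = #|row_group la|%:R *: ys la.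
Proof.
by rewrite young_symmetrizerE -gring_row_mul -mulmxA row_sum_sqr -scalemxAr linearZ.
Qed.

Lemma card_row_group_neq0 la : #|row_group la|%:R != 0 :> C.
Proof. by rewrite pnatr_eq0 -lt0n cardG_gt0. Qed.

(* The group algebra maps the ideal of the Young symmetrizer, followed by the
   row symmetrizer, onto a line: a submodule W on which the row symmetrizer does
   not vanish contains the generator; if it vanishes on W, then a complement of
   W contains the generator. *)
Lemma specht_simple la : mxsimple U (cyclic_mx U (ys la)).
Proof.
split; [exact: cyclic_mx_module | by rewrite cyclic_mx_eq0 young_symmetrizer_neq0 |].
move=> W modW sWV nzW.
have [WA0|] := eqVneq (W *m A la) 0; last first.
  case/rowV0Pn => v /submxP[w ->] nz.
  have /cyclic_mxP[X RX E] := submx_trans (submxMl w W) sWV.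
  have [k kE] := col_row_sum_line la (envelop_mxM (row_sum_in_ring la) RX).
  have wE : w *m (W *m A la) = k *: ys la.
    rewrite mulmxA E young_symmetrizerE -!gring_row_mul -linearZ /= -kE.
    by rewrite !mulmxA.
  have k0 : k != 0 by apply: contraNneq nz => k0; rewrite wE k0 scale0r.
  apply: cyclic_mx_sub => //.
  rewrite -[ys la]scale1r -(mulVf k0) -scalerA -wE scalemx_sub //.
  by rewrite mulmx_sub // (mxmodule_envelop modW) ?row_sum_in_ring.
have [W' modW' defV dxV] := mx_Maschke_pchar U pchar_sym modW (submx1 W).
suff sW'V : (cyclic_mx U (ys la) <= W')%MS.
  have : (W <= W :&: W')%MS by rewrite sub_capmx submx_refl (submx_trans sWV).
  by rewrite (mxdirect_addsP dxV) submx0 (negPf nzW).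
apply: cyclic_mx_sub => //.
have /sub_addsmxP[[w w'] /= E] : (ys la <= W + W')%MS by rewrite defV submx1.
rewrite -[ys la]scale1r -(mulVf (card_row_group_neq0 la)) -scalerA scalemx_sub //.
rewrite -young_symmetrizer_row_sum E mulmxDl -mulmxA WA0 mulmx0 add0r.
by rewrite -mulmxA mulmx_sub // (mxmodule_envelop modW') ?row_sum_in_ring.
Qed.

Lemma specht_irr la : mx_irreducible (specht_repr R la).
Proof. by apply/submod_mx_irr; apply: specht_simple. Qed.

(** Every vector of the Specht module is [ys la *m X] with [X] in the group ring, so a scalar action
    can be checked inside the regular representation. *)
Lemma specht_scalar la (f : 'S_n -> C) (s : C) :
  (forall X, (X \in group_ring C G)%MS ->
     ys la *m X *m (\sum_x f x *: U x) = s *: (ys la *m X)) ->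
  \sum_x f x *: specht_repr R la x = s%:M.
Proof.
move=> H; apply: val_submod_inj.
have -> : val_submod (\sum_x f x *: specht_repr R la x) =
    val_submod (1%:M : 'M_(\rank (cyclic_mx U (ys la)))) *m (\sum_x f x *: U x).
  rewrite linear_sum mulmx_sumr; apply: eq_bigr => x _.
  by rewrite -scalemxAr -[specht_repr R la x]mul1mx linearZ /= val_submodJ ?inE.
rewrite -[s%:M]scalemx1 linearZ /=; apply/row_matrixP=> i; rewrite row_mul linearZ /=.
have /cyclic_mxP[X RX ->] : (row i (val_submod (1%:M : 'M_(\rank (cyclic_mx U (ys la)))))
    <= cyclic_mx U (ys la))%MS.
  by rewrite (submx_trans (row_sub _ _)) // val_submodP.
exact: H.
Qed.

Lemma lex_gt_col_row_sum_ring la mu X : lex_gt la mu -> (X \in group_ring C G)%MS ->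
  B mu *m X *m A la = 0.
Proof.
move=> lm /envelop_mxP[a ->]; rewrite [B mu *m _]mulmx_sumr mulmx_suml big1 // => x _.
by rewrite -scalemxAr -scalemxAl lex_gt_col_row_sum // scaler0.
Qed.

(** The row symmetrizer of la acts as 0 on the module of mu, because [B mu *m X *m A la] vanishes,
    whereas it multiplies the generator of the module of la by the order of the row group. *)
Lemma specht_not_rsim la mu : lex_gt la mu ->
  ~ mx_rsim (specht_repr R la) (specht_repr R mu).
Proof.
move=> lm sim.
have mu0 : \sum_(p in row_group la) specht_repr R mu p = 0.
  transitivity (\sum_p (p \in row_group la)%:R *: specht_repr R mu p).
    by rewrite big_mkcond; apply: eq_bigr => p _; case: ifP; rewrite ?scale1r ?scale0r.
  transitivity ((0 : C)%:M : 'M_(\rank (cyclic_mx U (ys mu)))); last by rewrite raddf0.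
  apply: specht_scalar => X RX.
  rewrite scale0r.
  have -> : \sum_x (x \in row_group la)%:R *: U x = A la.
    by rewrite [RHS]big_mkcond; apply: eq_bigr => p _; case: ifP; rewrite ?scale1r ?scale0r.
  rewrite young_symmetrizerE -!gring_row_mul -[B mu *m _ *m X]mulmxA.
  have -> := lex_gt_col_row_sum_ring lm (envelop_mxM (row_sum_in_ring mu) RX).
  exact: linear0.
have la0 : \sum_(p in row_group la) specht_repr R la p = 0.
  by apply: (mx_rsim_sum0 sim); rewrite ?finset.subsetT.
have : ys la *m A la = 0.
  have sub : (ys la <= cyclic_mx U (ys la))%MS by exact: cyclic_mx_id.
  transitivity (val_submod (in_submod (cyclic_mx U (ys la)) (ys la) *m
     \sum_(p in row_group la) specht_repr R la p)).
    rewrite [LHS]mulmx_sumr [X in val_submod X]mulmx_sumr linear_sum; apply: eq_bigr => p _.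
    by rewrite /= val_submodJ ?inE // in_submodK.
  by rewrite la0 mulmx0 linear0.
rewrite young_symmetrizer_row_sum => /eqP; rewrite scaler_eq0.
by rewrite (negPf (card_row_group_neq0 la)) (negPf (young_symmetrizer_neq0 R la)).
Qed.

Lemma specht_rsim_inj la mu :
  mx_rsim (specht_repr R la) (specht_repr R mu) -> la = mu.
Proof.
move=> sim; apply: contrapT => /lex_gt_total[] h; first exact: specht_not_rsim sim.
exact: specht_not_rsim (mx_rsim_sym sim).
Qed.

(** Denominator of the coefficient of la in [Theta z n]; the numerator is the value at [z^*]. *)
Definition content_prod (z : C) la : C :=
  \prod_(b : 'I_n * 'I_n | in_diagram la b) (z + (content b)%:~R).

(** Only the products qp of a column and a row permutation contribute, each with the sign of q, so
    the sum is [row_col_sum] with trivial middle factor. *)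
Lemma col_row_sum_cycles (z : C) la :
  \sum_x z ^+ #|porbits x| *: (B la *m U x *m A la) =
  content_prod z la *: (B la *m A la).
Proof.
pose h (u : 'S_n * 'S_n) := (u.1 * u.2)%g.
pose D := finset.setX (col_group la) (row_group la).
(* If qp = q'p', then q'^-1 q = p' p^-1 lies in both groups, hence is trivial. *)
have hinj : {in D &, injective h}.
  move=> [q p] [q' p']; rewrite !finset.in_setX /= => /andP[qQ pP] /andP[q'Q p'P] E.
  have E2 : (q'^-1 * q = p' * p^-1)%g.
    by apply: (mulgI q'); rewrite mulKVg mulgA -[(q' * p')%g]E mulgK.
  have q1 : (q'^-1 * q = 1)%g.
    apply: (row_col_group_id (la := la)).
      by rewrite E2; apply: groupM; rewrite ?groupV.
    by apply: groupM; rewrite ?groupV.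
  have -> : q = q' by rewrite -[LHS](mulKVg q') q1 mulg1.
  have : (p' * p^-1 = 1)%g by rewrite -E2.
  by move=> p1; rewrite -[p' in RHS](mulgKV p) p1 mul1g.
transitivity (\sum_(x in [set h u | u in D]) z ^+ #|porbits x| *: (B la *m U x *m A la)).
  rewrite [LHS](bigID (mem [set h u | u in D])) /= [X in _ + X]big1 ?addr0 // => x xD.
  case: (col_row_sum_cases R la x) => [->|[q [p [qQ pP xE]]]]; first by rewrite scaler0.
  by case/imsetP: xD; exists (q, p); rewrite ?finset.in_setX /= ?qQ.
rewrite big_imset //=.
transitivity (row_col_sum z (reshape_index (rows la)) (reshape_offset (rows la)) (1 : 'S_n)%g
     *: (B la *m A la)).
  rewrite /row_col_sum pair_big scaler_suml; apply: eq_big => [[q p]|[q p]] /=.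
    by rewrite finset.in_setX.
  rewrite finset.in_setX /= => /andP[qQ pP]; rewrite col_row_sum_fact // scalerA mulg1.
  by rewrite mulrC.
rewrite row_col_sumE; last exact: tableau_like_young.
rewrite /content_prod (prod_content la (fun m : int => z + m%:~R)).
congr (_ *: _); apply: eq_bigr => k _.
by rewrite rmorphB /= addrA.
Qed.

(** The number of cycles is a class function, so [N] is central: it moves past [X] and in between
    the two symmetrizers, where its effect is known. *)
Lemma specht_cycles (z : C) la :
  \sum_x z ^+ #|porbits x| *: specht_repr R la x = (content_prod z la)%:M.
Proof.
apply: specht_scalar => X /envelop_mxP[a ->].
set N := \sum_x _.
have commN (y : 'S_n) : U y *m N = N *m U y.
  rewrite mulmx_sumr mulmx_suml [LHS](reindex_inj (conjg_inj y)) /=.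
  apply: eq_bigr => x _; rewrite card_porbitsJ -scalemxAr -scalemxAl -!regularM.
  by rewrite -conjgC.
have NX : (\sum_(x in G) a x *: U x) *m N = N *m (\sum_(x in G) a x *: U x).
  rewrite [LHS]mulmx_suml [RHS]mulmx_sumr; apply: eq_bigr => x _.
  by rewrite -scalemxAl commN scalemxAr.
rewrite -mulmxA NX mulmxA scalemxAl; congr (_ *m _).
rewrite young_symmetrizerE -gring_row_mul -linearZ /= -col_row_sum_cycles.
congr gring_row; rewrite -mulmxA.
have -> : A la *m N = N *m A la.
  rewrite [LHS]mulmx_suml [RHS]mulmx_sumr; apply: eq_bigr => p _; exact: commN.
rewrite mulmxA [B la *m N]mulmx_sumr mulmx_suml; apply: eq_bigr => x _.
by rewrite -scalemxAr -scalemxAl.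
Qed.

End SpechtIrreducible.

(** * Conjugacy classes and completeness *)

Lemma eq_permX_porbit (T : finType) (s : {perm T}) (a : T) m l :
  ((s ^+ m)%g a == (s ^+ l)%g a) = (m == l %[mod #|porbit s a|]).
Proof.
set N := #|porbit s a|.
have N0 : (0 < N)%N by rewrite lt0n card_porbit_neq0.
have modX k : (s ^+ k)%g a = (s ^+ (k %% N))%g a.
  rewrite {1}(divn_eq k N) expgD permM mulnC expgM.
  have -> // : ((s ^+ N) ^+ (k %/ N))%g a = a.
  by apply: permX_fix; rewrite permX iter_porbit.
rewrite (modX m) (modX l) !permX.
rewrite -!(nth_traject s (n := N)) ?ltn_pmod //.
by rewrite nth_uniq ?size_traject ?ltn_pmod ?uniq_traject_porbit.
Qed.

Section CycleType.
Variable n : nat.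
Implicit Types x y : 'S_n.

Definition orbits_by_size x : seq {set 'I_n} :=
  sort (fun X Y : {set 'I_n} => #|Y| <= #|X|)%N (enum (porbits x)).

Definition cycle_type x : seq nat := map (fun X : {set 'I_n} => #|X|) (orbits_by_size x).

Lemma mem_orbits_by_size x : orbits_by_size x =i porbits x.
Proof. by move=> X; rewrite mem_sort mem_enum. Qed.

Lemma sorted_cycle_type x : sorted geq (cycle_type x).
Proof. by rewrite sorted_map; apply: sort_sorted => X Y /=; exact: leq_total. Qed.

Lemma sumn_cycle_type x : sumn (cycle_type x) = n.
Proof.
rewrite sumnE big_map (perm_big (enum (porbits x))) ?(permEl (perm_sort _ _)) //=.
rewrite big_enum /= -[RHS]card_ord -sum1_card.
rewrite (partition_big (porbit x) (mem (porbits x))) /= => [|i _]; last exact: imset_f.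
apply: eq_bigr => _ /imsetP[a _ ->]; rewrite -sum1_card.
by apply: eq_bigl => i; rewrite eq_porbit_mem.
Qed.

Lemma cycle_type_gt0 x : all (leq 1) (cycle_type x).
Proof.
apply/allP=> _ /mapP[X + ->]; rewrite mem_orbits_by_size => /imsetP[a _ ->].
by rewrite lt0n card_porbit_neq0.
Qed.

Lemma size_cycle_type x : (size (cycle_type x) <= n)%N.
Proof.
rewrite -[X in (_ <= X)%N](sumn_cycle_type x); elim: (cycle_type x) (cycle_type_gt0 x) => //= k s IH.
by case/andP=> k0 /IH; rewrite -add1n; apply: leq_add.
Qed.

End CycleType.

(** Sorting by size matches each orbit of x with an orbit of y of the same size ([phi]). With a base
    point in every orbit ([rho]), the conjugating map sends x^k of a base point to y^k of the
    matching one. *)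
Lemma cycle_type_conj n (x y : 'S_n) : cycle_type x = cycle_type y -> exists g, (x ^ g)%g = y.
Proof.
case: n x y => [|m] x y xy; first by exists 1%g; apply/permP=> -[].
pose phi (X : {set 'I_m.+1}) := nth finset.set0 (orbits_by_size y) (index X (orbits_by_size x)).
have szE : size (orbits_by_size x) = size (orbits_by_size y).
  by rewrite -(size_map (fun X : {set _} => #|X|)) -/(cycle_type x) xy size_map.
have ilt X : X \in porbits x -> (index X (orbits_by_size x) < size (orbits_by_size y))%N.
  by rewrite -szE index_mem mem_orbits_by_size.
have phi_in X : X \in porbits x -> phi X \in porbits y.
  by move=> /ilt h; rewrite -mem_orbits_by_size mem_nth.
have phi_card X : X \in porbits x -> #|phi X| = #|X|.
  move=> Xx; have h := ilt X Xx; rewrite -(nth_map _ 0%N (fun Y : {set _} => #|Y|)) //.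
  rewrite -/(cycle_type y) -xy (nth_map finset.set0) ?szE //.
  by rewrite nth_index ?mem_orbits_by_size.
have phi_inj : {in porbits x &, injective phi}.
  move=> X Y Xx Yx /eqP; rewrite nth_uniq ?ilt //; last by rewrite sort_uniq enum_uniq.
  move/eqP=> E; rewrite -[X](nth_index finset.set0 (s := orbits_by_size x)) ?mem_orbits_by_size //.
  by rewrite E nth_index ?mem_orbits_by_size.
pose rho (X : {set 'I_m.+1}) : 'I_m.+1 := odflt ord0 [pick i in X].
have rhoP (s : 'S_m.+1) X : X \in porbits s -> porbit s (rho X) = X.
  case/imsetP=> a _ ->; apply/eqP; rewrite eq_porbit_mem /rho.
  by case: pickP => // /(_ a); rewrite porbit_id.
have xin i : porbit x i \in porbits x by exact: imset_f.
have kP i : exists k, i == (x ^+ k)%g (rho (porbit x i)).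
  have : i \in porbit x (rho (porbit x i)) by rewrite rhoP ?porbit_id.
  by case/porbitP=> k ->; exists k; rewrite porbit_perm rhoP.
pose k i := xchoose (kP i).
have kE i : (x ^+ k i)%g (rho (porbit x i)) = i by apply/esym/eqP/(xchooseP (kP i)).
pose g i := (y ^+ k i)%g (rho (phi (porbit x i))).
(* Equality of powers at a point only depends on the exponents modulo the orbit size, which [phi]
   preserves; hence the choice of exponent [k] is immaterial. *)
have transfer X p q : X \in porbits x ->
    ((x ^+ p)%g (rho X) == (x ^+ q)%g (rho X)) =
    ((y ^+ p)%g (rho (phi X)) == (y ^+ q)%g (rho (phi X))).
  by move=> Xx; rewrite !eq_permX_porbit !rhoP ?phi_card ?phi_in.
have porbit_x i : porbit x (x i) = porbit x i by exact: (porbit_perm x 1 i).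
have gx i : g (x i) = y (g i).
  rewrite /g porbit_x -permM -expgSr; apply/eqP; rewrite -transfer //; apply/eqP.
  by rewrite expgSr permM kE -(porbit_x i) kE.
have gI : injective g.
  move=> i j gij; have e : porbit x i = porbit x j.
    apply: phi_inj => //; have := congr1 (porbit y) gij.
    by rewrite /g !porbit_perm !rhoP ?phi_in.
  move/eqP: gij; rewrite /g e -(transfer _ _ _ (xin j)) => /eqP.
  by rewrite -{1}e !kE.
exists (perm gI); apply/permP=> i.
rewrite conjgE !permM permE gx -[in RHS](permKV (perm gI) i) permE.
by [].
Qed.

(** The filter undoes the padding with zero rows in the encoding of diagrams. *)
Lemma young_cycle_type n (x : 'S_n) :
  exists la : young n, [seq k <- rows la | (0 < k)%N] = cycle_type x.
Proof.
pose s := cycle_type x ++ nseq (n - size (cycle_type x)) 0%N.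
have sz : size s = n by rewrite size_cat size_nseq subnKC // size_cycle_type.
have sle k : k \in s -> (k < n.+1)%N.
  move=> ks; rewrite ltnS.
  have : (k <= sumn s)%N.
    elim: s ks {sz} => //= a s IH; rewrite inE => /orP[/eqP->|/IH h].
      exact: leq_addr.
    exact: leq_trans h (leq_addl _ _).
  by rewrite sumn_cat sumn_nseq mul0n addn0 sumn_cycle_type.
have szt : size (map (@inord n) s) == n by rewrite size_map sz.
have valt : map val (map (@inord n) s) = s.
  by rewrite -map_comp map_id_in // => k /sle h /=; rewrite inordK.
have yP : is_young (Tuple szt).
  rewrite /is_young /= valt sumn_cat sumn_nseq mul0n addn0 sumn_cycle_type eqxx andbT.
  have tr : transitive geq by move=> a b c /= ab bc; apply: leq_trans bc ab.
  rewrite sorted_pairwise // pairwise_cat -!sorted_pairwise // sorted_cycle_type /=.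
  apply/andP; split; last by elim: (n - _)%N => //= k; case: k.
  by apply/allrelP=> a b _; rewrite mem_nseq => /andP[_ /eqP ->].
exists (exist _ (Tuple szt) yP); rewrite /rows /= valt filter_cat.
rewrite (all_filterP (cycle_type_gt0 x)) (eq_in_filter (a2 := pred0)) ?filter_pred0 ?cats0 //.
by move=> k; rewrite mem_nseq => /andP[_ /eqP ->].
Qed.

Lemma card_classes_sym n : (#|classes [set: 'S_n]| <= #|young n|)%N.
Proof.
(* [f] picks a permutation of cycle type la, with default value [1%g]. The classes of these
   permutations exhaust all classes, since equal cycle types imply conjugacy. *)
have ex (la : young n) : exists x : 'S_n,
    (exists x : 'S_n, cycle_type x = [seq k <- rows la | (0 < k)%N]) ->
    cycle_type x = [seq k <- rows la | (0 < k)%N].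
  have [h|h] := pselect (exists x : 'S_n, cycle_type x = [seq k <- rows la | (0 < k)%N]).
    by have [x xP] := h; exists x.
  by exists 1%g.
have [f fP] := choice ex.
pose h (la : young n) := (f la ^: [set: 'S_n])%g.
apply: (@leq_trans #|[set h la | la : young n]|); last exact: leq_imset_card.
apply: subset_leq_card; apply/fintype.subsetP=> _ /imsetP[x _ ->].
have [la laP] := young_cycle_type x.
have [g gE] : exists g, (x ^ g)%g = f la.
  by apply: cycle_type_conj; rewrite fP -?laP //; exists x; rewrite laP.
apply/imsetP; exists la => //; apply/esym/class_eqP; rewrite -gE.
by apply: memJ_class; rewrite inE.
Qed.

Section SpechtComplete.
Variables (R : realType) (n : nat).
Local Notation C := R[i].
Local Notation G := [set: 'S_n]%G.

(* The Specht modules are pairwise non-isomorphic, and there are at least as many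
   of them as conjugacy classes, so they exhaust the irreducible representations. *)
Lemma sum_dim_irr_char (x : 'S_n) :
  \sum_(la : young n) dim_char la * irr_char la x = (n`! * (x == 1)%g)%:R :> C.
Proof.
pose sG := DecSocleType (regular_repr C G).
have splitG : group_splitting_field C G := @group_closure_closed_field C _ G.
pose phi (la : young n) := irr_comp sG (specht_repr R la).
have sim la := rsim_irr_comp_pchar sG (pchar_sym R n) (specht_irr R la).
have phi_inj : injective phi.
  move=> la mu E; apply: (specht_rsim_inj (R := R)).
  have := sim la; rewrite -/(phi la) E => s1; exact: mx_rsim_trans s1 (mx_rsim_sym (sim mu)).
have phi_bij : bijective phi.
  by apply: (inj_card_bij phi_inj); rewrite card_irr_pchar ?card_classes_sym //; exact: pchar_sym.
(* The regular character is the sum of degree times character over all irreducibles, and it is n! at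
   the identity and 0 elsewhere. *)
transitivity (\tr (regular_repr C G x)).
  rewrite (mxtrace_regular_pchar sG (pchar_sym R n) splitG) ?inE //.
  rewrite (reindex phi) /=; last by case: phi_bij => f fK Kf; exists f.
  apply: eq_bigr => la _; rewrite /dim_char /irr_char.
  rewrite (mxtrace_rsim (sim la)) ?inE // (mxtrace_rsim (sim la)) ?inE // repr_mx1 mxtrace1.
  by rewrite mulr_natl.
rewrite /mxtrace (eq_bigr (fun=> (x == 1)%g%:R)) => [|i _].
  by rewrite sumr_const card_ord /gcard cardsT card_Sn mulnC natrM mulr_natr.
rewrite !mxE eqxx /= -(inj_eq (can_inj (gring_valK (G := G)))) gring_indexK ?inE //.
by rewrite -{1}[enum_val i]mulg1 (inj_eq (mulgI _)) eq_sym.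
Qed.

End SpechtComplete.

(** * Convolution with central functions *)

Lemma card_porbitsV n (x : 'S_n) : #|porbits (x^-1)%g| = #|porbits x|.
Proof. by rewrite porbitsV. Qed.

Lemma card_porbitsC n (x y : 'S_n) : #|porbits (x * y)%g| = #|porbits (y * x)%g|.
Proof. by rewrite -(card_porbitsJ (y * x)%g y) conjgE mulgA mulKg. Qed.

Section ReprTrace.
Variables (F : fieldType) (gT : finGroupType) (m : nat).
Variable r : mx_representation F [set: gT] m.

Lemma mxtrace_reprC x y : \tr (r (x * y)%g) = \tr (r (y * x)%g).
Proof. by rewrite !repr_mxM ?inE // mxtrace_mulC. Qed.

(** The trace of [r x] times the scalar operator, reindexed: it turns a scalar action into an
    eigenvalue equation of the character under convolution. *)
Lemma mxtrace_repr_scalar (f : gT -> F) (s : F) (x : gT) :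
  \sum_y f y *: r y = s%:M -> (forall y, f (y^-1)%g = f y) ->
  \sum_y f (y^-1 * x)%g * \tr (r y) = s * \tr (r x).
Proof.
move=> rs fV; rewrite -mxtraceZ -mul_mx_scalar -rs mulmx_sumr raddf_sum /=.
rewrite (reindex_inj (inj_comp (mulgI x) invg_inj)) [RHS](reindex_inj invg_inj) /=.
apply: eq_bigr => y _.
by rewrite invMg invgK mulgKV -scalemxAr mxtraceZ fV repr_mxM ?inE.
Qed.

End ReprTrace.

Section Convolution.
Variables (R : realType) (n : nat).
Local Notation C := R[i].

Definition cycle_fun (z : C) : Hn R n := [ffun x : 'S_n => z ^+ #|porbits x|].

(** Normalized so that phi = 1 gives the unit of the convolution; [Theta] is the case of the content
    ratios. *)
Definition char_sum (phi : young n -> C) : Hn R n :=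
  [ffun x : 'S_n => \sum_la phi la * dim_char la * irr_char la x].

Lemma irr_charC la (x y : 'S_n) : irr_char la (x * y)%g = irr_char la (y * x)%g :> C.
Proof. exact: mxtrace_reprC. Qed.

Lemma char_sum_central phi : central (char_sum phi).
Proof.
move=> x y; rewrite !ffunE; apply: eq_bigr => la _.
by rewrite irr_charC.
Qed.

Lemma convolution_cycle_fun z phi :
  convolution (cycle_fun z) (char_sum phi) =
  n`!%:R^-1 *: char_sum (fun la => phi la * content_prod z la).
Proof.
apply/ffunP=> x; rewrite !ffunE; congr (_ * _).
under eq_bigr => y _ do rewrite !ffunE mulr_sumr.
rewrite exchange_big /=; apply: eq_bigr => la _.
transitivity (phi la * dim_char la * (content_prod z la * irr_char la x)); last first.
  by rewrite mulrA [_ * content_prod z la]mulrAC.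
have -> : content_prod z la * irr_char la x =
    \sum_(y : 'S_n) z ^+ #|porbits (y^-1 * x)%g| * irr_char la y.
  rewrite -(mxtrace_repr_scalar x (specht_cycles z la)) // => y.
  by rewrite card_porbitsV.
rewrite [RHS]mulr_sumr; apply: eq_bigr => y _.
by rewrite mulrCA.
Qed.

Lemma char_sum1 : char_sum (fun=> 1) = [ffun x : 'S_n => (n`! * (x == 1)%g)%:R].
Proof.
apply/ffunP=> x; rewrite !ffunE -sum_dim_irr_char.
by apply: eq_bigr => la _; rewrite mul1r.
Qed.

Lemma factC_neq0 : n`!%:R != 0 :> C.
Proof. by rewrite pnatr_eq0 -lt0n fact_gt0. Qed.

(** Convolve the cycle function with the unit [char_sum (fun=> 1)]. *)
Lemma cycle_funE z : cycle_fun z = n`!%:R^-1 *: char_sum (content_prod z).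
Proof.
transitivity (convolution (cycle_fun z) (char_sum (fun=> 1))).
  apply/ffunP=> x; rewrite char_sum1 !ffunE.
  rewrite (bigD1 1%g) //= big1 ?addr0; last first.
    by move=> y /negPf y1; rewrite !ffunE y1 muln0 mulr0.
  by rewrite !ffunE eqxx muln1 invg1 mul1g mulrCA mulVf ?factC_neq0 ?mulr1.
rewrite convolution_cycle_fun; congr (_ *: _); apply/ffunP=> x; rewrite !ffunE.
by apply: eq_bigr => la _; rewrite mul1r.
Qed.

Lemma content_prod_neq0 z (la : young n) :
  (forall k : int, z <> k%:~R) -> content_prod z la != 0 :> C.
Proof.
move=> zn; apply/prodf_neq0 => b _; apply/eqP => /eqP.
by rewrite addr_eq0 -rmorphN /= => /eqP; apply: zn.
Qed.

(** The scalars of [cycle_fun z] cancel the denominators of [Theta], nonzero as z is not an integer,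
    and leave the content products at [z^*]. *)
Lemma convolution_cycle_fun_Theta z : (forall k : int, z <> k%:~R) ->
  convolution (cycle_fun z) (Theta z n) = cycle_fun z^*.
Proof.
move=> zn; rewrite [RHS]cycle_funE -/(char_sum _) convolution_cycle_fun.
congr (_ *: _); apply/ffunP=> x; rewrite !ffunE; apply: eq_bigr => la _.
by rewrite prodf_div -/(content_prod z la) divfK ?content_prod_neq0.
Qed.

(** Expand f in point masses, and write the mass at 1 as the convolution of the cycle function with
    [w]: this exhibits f as a combination of translates. *)
Lemma cycle_fun_cyclic z (f : Hn R n) : (forall k : int, z <> k%:~R) ->
  exists a : 'S_n * 'S_n -> C, forall x, f x =
    \sum_u a u * cycle_fun z ((u.1 * u.2)^-1 * x)%g.
Proof.
move=> zn.
(* w inverts cycle_fun z for the convolution. *)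
pose w := char_sum (fun la => (content_prod z la)^-1).
have wE : convolution (cycle_fun z) w = [ffun x : 'S_n => (x == 1)%g%:R].
  rewrite convolution_cycle_fun.
  transitivity (n`!%:R^-1 *: char_sum (fun=> 1)).
    congr (_ *: _); apply/ffunP=> x; rewrite !ffunE; apply: eq_bigr => la _.
    by rewrite mulVf ?content_prod_neq0.
  apply/ffunP=> x; rewrite char_sum1 !ffunE natrM.
  by rewrite /GRing.scale /= mulrA mulVf ?factC_neq0 ?mul1r.
exists (fun u => f u.1 * (n`!%:R^-1 * w u.2)) => x.
rewrite -(pair_bigA _ (fun u y => f u * (n`!%:R^-1 * w y) * cycle_fun z ((u * y)^-1 * x)%g)) /=.
transitivity (\sum_u f u * (convolution (cycle_fun z) w (u^-1 * x)%g)).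
  rewrite wE (bigD1 x) //= big1 ?addr0 => [|u /negPf ux].
    by rewrite ffunE mulVg eqxx mulr1.
  by rewrite ffunE -eq_mulVg1 ux mulr0.
apply: eq_bigr => u _; rewrite ffunE mulrA mulr_sumr; apply: eq_bigr => y _.
by rewrite invMg mulgA; ring.
Qed.

End Convolution.

(** The norm of a combination depends only on its coefficients and on the Gram matrix of the
    family. *)
Lemma sum_gram (C : numClosedFieldType) (I J : finType) (a : I -> C) (F F' : I -> J -> C) :
  (forall u v, \sum_x F u x * (F v x)^* = \sum_x F' u x * (F' v x)^*) ->
  \sum_x (\sum_u a u * F u x) * (\sum_u a u * F u x)^* =
  \sum_x (\sum_u a u * F' u x) * (\sum_u a u * F' u x)^*.
Proof.
move=> FF'.
have E (K : I -> J -> C) : \sum_x (\sum_u a u * K u x) * (\sum_u a u * K u x)^* =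
    \sum_u \sum_v (a u * (a v)^*) * \sum_x K u x * (K v x)^*.
  under eq_bigr => x _ do rewrite rmorph_sum big_distrlr /=.
  rewrite exchange_big; apply: eq_bigr => u _.
  rewrite exchange_big; apply: eq_bigr => v _.
  rewrite mulr_sumr; apply: eq_bigr => x _.
  by rewrite rmorphM mulrACA.
by rewrite !E; apply: eq_bigr => u _; apply: eq_bigr => v _; rewrite FF'.
Qed.

(** * Convolution with Theta on a single H^n *)

Section RegularLinear.
Variables (R : realType) (n : nat).
Local Notation C := R[i].

Lemma Reg_is_linear (g : 'S_n * 'S_n) : linear (@Reg R n g).
Proof. by move=> a f h; apply/ffunP=> x; rewrite !ffunE. Qed.
HB.instance Definition _ g :=
  GRing.isLinear.Build C (Hn R n) (Hn R n) *:%R (@Reg R n g) (Reg_is_linear g).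

Lemma Lz_is_linear z : linear (@Lz R z n).
Proof.
move=> a f h; apply/ffunP=> x; rewrite !ffunE /GRing.scale /=.
by case: in_subgroup; ring.
Qed.
HB.instance Definition _ z :=
  GRing.isLinear.Build C (Hn R n) (Hn R n.+1) *:%R (@Lz R z n) (Lz_is_linear z).

(** The arguments are swapped so that the linear structure concerns the function being acted on. *)
Definition convolver (h f : Hn R n) : Hn R n := convolution f h.

Lemma convolver_is_linear h : linear (convolver h).
Proof.
move=> a f k; apply/ffunP=> x; rewrite !ffunE /GRing.scale /= mulrCA -mulrDr.
congr (_ * _); rewrite mulr_sumr -big_split; apply: eq_bigr => y _.
by rewrite !ffunE /GRing.scale /= mulrDl mulrA.
Qed.
HB.instance Definition _ h :=
  GRing.isLinear.Build C (Hn R n) (Hn R n) *:%R (convolver h) (convolver_is_linear h).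

(** Conjugating the summation variable by [g.1] moves the translation out of the sum, and a central
    [h] does not see the conjugation. *)
Lemma convolver_Reg h (g : 'S_n * 'S_n) f :
  central h -> convolver h (Reg g f) = Reg g (convolver h f).
Proof.
move=> ch; apply/ffunP=> x; rewrite !ffunE; congr (_ * _).
rewrite (reindex_inj (conjg_inj g.1)) /=; apply: eq_bigr => y _; rewrite !ffunE.
congr (f _ * _); last by rewrite conjgE ch -mulgA mulgV mulg1.
by rewrite conjgE !invMg invgK !mulgA mulgV mul1g.
Qed.

Lemma Theta_central (z : C) : central (Theta z n).
Proof. exact: char_sum_central. Qed.

Definition Fz_coef (z : C) : C :=
  sqrtC (n`!%:R / \prod_(0 <= k < n) (`|z| ^+ 2 + k%:R)).

Lemma FzE (z : C) : Fz z n = Fz_coef z *: cycle_fun n z.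
Proof. by apply/ffunP=> x; rewrite !ffunE. Qed.

Lemma Fz_coef_conj (z : C) : Fz_coef z^* = Fz_coef z.
Proof. by rewrite /Fz_coef norm_conjC. Qed.

Lemma Fz_coef_neq0 (z : C) : z != 0 -> Fz_coef z != 0.
Proof.
move=> z0; rewrite sqrtC_eq0 mulf_neq0 ?pnatr_eq0 -?lt0n ?fact_gt0 // invr_eq0.
rewrite prodf_seq_neq0; apply/allP=> k _ /=.
by rewrite gt_eqF // ltr_pwDl ?exprn_gt0 ?normr_gt0.
Qed.

Lemma convolver_Fz (z : C) : (forall k : int, z <> k%:~R) ->
  convolver (Theta z n) (Fz z n) = Fz z^* n.
Proof.
move=> zn; rewrite !FzE linearZ /= Fz_coef_conj; congr (_ *: _).
exact: convolution_cycle_fun_Theta.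
Qed.

Lemma Fz_cyclic (z : C) (f : Hn R n) : (forall k : int, z <> k%:~R) ->
  exists (a : 'S_n * 'S_n -> C) (g : 'S_n * 'S_n -> 'S_n),
    f = \sum_u a u *: Reg (g u, 1%g) (Fz z n).
Proof.
move=> zn; have [a aE] := cycle_fun_cyclic f zn.
have z0 : z != 0 by apply/eqP; exact: (zn 0).
exists (fun u => a u / Fz_coef z), (fun u => ((u.1 * u.2)^-1)%g).
apply/ffunP=> x; rewrite aE sum_ffunE; apply: eq_bigr => u _.
rewrite FzE !ffunE /GRing.scale /= mulrA divfK ?Fz_coef_neq0 //.
by rewrite invg1 mulg1.
Qed.

(* The substitution x -> g^-1 x^-1 h^-1 exchanges, up to inversion and
   conjugation, g x and h x. *)
Lemma cycle_fun_corr (z : C) (g h : 'S_n) :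
  \sum_x cycle_fun n z (g * x)%g * (cycle_fun n z (h * x)%g)^* =
  \sum_x cycle_fun n z^* (g * x)%g * (cycle_fun n z^* (h * x)%g)^*.
Proof.
have inj : injective (fun x => g^-1 * (x^-1 * h^-1))%g.
  by move=> x y /mulgI/mulIg/invg_inj.
rewrite (reindex_inj inj) /=; apply: eq_bigr => x _; rewrite !ffunE mulKVg.
rewrite !rmorphXn /= conjCK mulrC; congr (_ ^+ _ * _ ^+ _).
  rewrite -[RHS]card_porbitsV invMg [RHS]card_porbitsC.
  by rewrite -(card_porbitsJ (g^-1 * x^-1)%g (h^-1)%g) conjgE invgK !mulgA.
by rewrite -[RHS]card_porbitsV invMg.
Qed.

Lemma convolver_isometric (z : C) (f : Hn R n) : (forall k : int, z <> k%:~R) ->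
  inner_Hn (convolver (Theta z n) f) (convolver (Theta z n) f) = inner_Hn f f.
Proof.
move=> zn; have [a [g fE]] := Fz_cyclic f zn.
(* By equivariance the image is the same combination of translates, now of the vector for [z^*];
   only the two Gram matrices remain to be compared. *)
have fE' : convolver (Theta z n) f = \sum_u a u *: Reg (g u, 1%g) (Fz z^* n).
  rewrite fE linear_sum; apply: eq_bigr => u _.
  rewrite linearZ /= convolver_Reg ?convolver_Fz //; exact: Theta_central.
have pt (w : C) (h : Hn R n) (x : 'S_n) : h = \sum_u a u *: Reg (g u, 1%g) (Fz w n) ->
    h x = \sum_u a u * (Fz_coef w * cycle_fun n w (g u * x)%g).
  move=> ->; rewrite sum_ffunE; apply: eq_bigr => u _.
  by rewrite FzE !ffunE /= invg1 mulg1.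
rewrite /inner_Hn; congr (_ * _).
under eq_bigr => x _ do rewrite (pt _ _ x fE').
under [RHS]eq_bigr => x _ do rewrite (pt _ _ x fE).
apply: sum_gram => u v; rewrite Fz_coef_conj.
have E (k c d : C) : (k * c) * (k * d)^* = (k * k^*) * (c * d^*).
  by rewrite rmorphM mulrACA.
under eq_bigr => x _ do rewrite E.
under [RHS]eq_bigr => x _ do rewrite E.
by rewrite -[LHS]mulr_sumr -[RHS]mulr_sumr; congr (_ * _); apply/esym/cycle_fun_corr.
Qed.

End RegularLinear.

(** Both sides are linear and equivariant, so cyclicity reduces the identity to [Fz z n], which both
    sides send to [Fz z^* n.+1]. *)
Lemma convolver_Lz (R : realType) n (z : R[i]) (f : Hn R n) :
  (forall k : int, z <> k%:~R) ->
  convolver (Theta z n.+1) (Lz z f) = Lz z^* (convolver (Theta z n) f).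
Proof.
move=> zn; have [a [g ->]] := Fz_cyclic f zn.
rewrite !linear_sum; apply: eq_bigr => u _; rewrite !linearZ /=; congr (_ *: _).
rewrite Lz_equivariant !convolver_Reg; try exact: Theta_central.
by rewrite Lz_Fz !convolver_Fz // Lz_equivariant Lz_Fz.
Qed.

(** * Extension of densely defined isometries *)

Section Extension.
Variables (K : numFieldType) (V W : completeNormedModType K).

Lemma normr_lt_eps0 (x : W) : (forall e : K, 0 < e -> `|x| < e) -> x = 0.
Proof.
move=> h; apply/eqP/negPn/negP => x0.
by have := h `|x|; rewrite normr_gt0 x0 ltxx => /(_ isT).
Qed.

Lemma pos_min2 (e f : K) : 0 < e -> 0 < f -> exists g, [/\ 0 < g, g <= e & g <= f].
Proof.
move=> e0 f0; case: (real_leP (gtr0_real e0) (gtr0_real f0)) => h.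
  by exists e.
by exists f; split=> //; apply: ltW.
Qed.

Lemma dense_norm_lt (S : set V) (v : V) (e : K) : dense S -> 0 < e ->
  exists d, S d /\ `|v - d| < e.
Proof.
move=> dS e0; have [|d [dO Sd]] := dS (ball v e)^°%classic _ (@open_interior _ _).
  by exists v; apply: nbhsx_ballx.
by exists d; split=> //; move: (interior_subset dO); rewrite -ball_normE.
Qed.

Lemma bounded_linear_dense_eq (A B : {linear V -> W}) (M N : K) (S : set V) :
  (forall v, `|A v| <= M * `|v|) -> (forall v, `|B v| <= N * `|v|) ->
  dense S -> (forall d, S d -> A d = B d) -> forall v, A v = B v.
Proof.
move=> bA bB dS AB v; apply/eqP; rewrite -subr_eq0; apply/eqP/normr_lt_eps0 => e e0.
(* The given constants need not be nonnegative when V is zero, so absolute values replace them. *)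
have nM (L : K) (F : {linear V -> W}) : (forall v, `|F v| <= L * `|v|) ->
    forall v, `|F v| <= `|L| * `|v|.
  move=> bF u; rewrite -[X in `|L| * X]normr_id -normrM ger0_norm //.
  exact: le_trans (normr_ge0 _) (bF u).
have c0 : 0 < `|M| + `|N| + 1 by rewrite ltr_wpDl ?addr_ge0.
have [d [Sd vd]] := dense_norm_lt v dS (divr_gt0 e0 c0).
have -> : A v - B v = A (v - d) - B (v - d).
  by rewrite (raddfB A) (raddfB B) /= (AB d Sd) opprB addrA subrK.
apply: le_lt_trans (ler_normB _ _) _.
apply: le_lt_trans (lerD (nM _ _ bA _) (nM _ _ bB _)) _.
rewrite -mulrDl; apply: le_lt_trans (_ : (`|M| + `|N| + 1) * `|v - d| < e).
  by rewrite ler_wpM2r // lerDl.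
by rewrite mulrC -ltr_pdivlMr.
Qed.

Variable D0 : V -> W -> Prop.
Hypothesis D0_linear : forall a d w d' w',
  D0 d w -> D0 d' w' -> D0 (a *: d + d') (a *: w + w').
Hypothesis D0_isometric : forall d w, D0 d w -> `|w| = `|d|.
Hypothesis D0_dense : dense [set d | exists w, D0 d w].

(** Closure of the graph [D0]; it turns out to be the graph of the extension. *)
Definition near_graph v w := forall e : K, 0 < e ->
  exists d w', [/\ D0 d w', `|v - d| < e & `|w - w'| < e].

Lemma D0_dist d w d' w' : D0 d w -> D0 d' w' -> `|w - w'| = `|d - d'|.
Proof.
move=> h h'; have := D0_isometric (D0_linear (-1) h' h).
by rewrite !scaleN1r ![- _ + _]addrC.
Qed.

(** As [D0] preserves distances, the images of approximants of [v] generate a Cauchy filter, and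
    completeness of W provides the limit. *)
Lemma near_graph_ex v : exists w, near_graph v w.
Proof.
pose F : set_system W := fun P => exists2 e : K, 0 < e & forall d w, D0 d w -> `|v - d| < e -> P w.
have FF : ProperFilter F.
  split.
    case=> e e0 h; have [d [[w dw] vd]] := dense_norm_lt v D0_dense e0.
    exact: h dw vd.
  split.
  - by exists 1.
  - move=> P Q [e e0 eP] [f f0 fQ]; have [g [g0 ge gf]] := pos_min2 e0 f0.
    exists g => // d w dw vd; split.
      exact: eP dw (lt_le_trans vd ge).
    exact: fQ dw (lt_le_trans vd gf).
  - by move=> P Q PQ [e e0 eP]; exists e => // d w dw vd; apply/PQ/(eP d).
have cF : cauchy F.
  apply: cauchy_exP => e e0.
  have e20 : 0 < e / 2 by rewrite divr_gt0.
  have [d [[w dw] vd]] := dense_norm_lt v D0_dense e20.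
  exists w, (e / 2) => // d' w' dw' vd'; rewrite -ball_normE /ball_ /= (D0_dist dw dw').
  rewrite -(subrK v d) -addrA; apply: le_lt_trans (ler_normD _ _) _.
  by rewrite [ltRHS]splitr ltrD // distrC.
have wF := (cauchy_cvgP F).1 cF.
pose w : W := lim F; exists w => e e0; have [f f0 fP] : F (ball w e) by apply: wF; apply: nbhsx_ballx.
have [g [g0 ge gf]] := pos_min2 e0 f0.
have [d [[w' dw] vd]] := dense_norm_lt v D0_dense g0.
exists d, w'; split=> //; first exact: lt_le_trans vd ge.
by have := fP d w' dw (lt_le_trans vd gf); rewrite -ball_normE.
Qed.

Lemma near_graph_uniq v w w' : near_graph v w -> near_graph v w' -> w = w'.
Proof.
move=> h h'; apply/eqP; rewrite -subr_eq0; apply/eqP/normr_lt_eps0 => e e0.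
(* The outer terms below cost e/4 each; the middle one has the norm of d - d' by isometry, and d, d'
   both lie within e/4 of v. *)
have e40 : 0 < e / 2 / 2 by rewrite !divr_gt0.
have [d [u [du vd wu]]] := h _ e40; have [d' [u' [du' vd' wu']]] := h' _ e40.
have -> : w - w' = (w - u) + (u - u') + (u' - w') by rewrite !addrA !subrK.
have -> : e = e / 2 / 2 + (e / 2 / 2 + e / 2 / 2) + e / 2 / 2.
  by rewrite -splitr addrAC -!splitr.
apply: le_lt_trans (ler_normD _ _) _; apply: ltrD; last by rewrite distrC.
apply: le_lt_trans (ler_normD _ _) _; apply: ltrD => //.
rewrite (D0_dist du du') -(subrK v d) -addrA.
by apply: le_lt_trans (ler_normD _ _) _; apply: ltrD => //; rewrite distrC.
Qed.

Lemma isometric_extension : exists A : {linear V -> W},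
  (forall d w, D0 d w -> A d = w) /\ (forall v, `|A v| = `|v|).
Proof.
have [A AP] := choice near_graph_ex.
have linA : linear A.
  move=> a v v'; apply: near_graph_uniq (AP _) _ => e e0.
  have a0 : 0 < `|a| + 1 by rewrite ltr_wpDl.
  (* Forming a d + d' multiplies the error by at most |a| + 1. *)
  have f0 : 0 < e / (`|a| + 1) by rewrite divr_gt0.
  have [d [w [dw vd Aw]]] := AP v _ f0; have [d' [w' [dw' vd' Aw']]] := AP v' _ f0.
  have bd (U : normedModType K) (x x' y y' : U) : `|x - y| < e / (`|a| + 1) ->
      `|x' - y'| < e / (`|a| + 1) -> `|a *: x + x' - (a *: y + y')| < e.
    move=> xy xy'; rewrite opprD addrACA -scalerBr.
    apply: le_lt_trans (ler_normD _ _) _; rewrite normrZ.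
    rewrite -[ltRHS](divfK (lt0r_neq0 a0)) mulrDr mulr1 [_ * `|a|]mulrC.
    by rewrite ler_ltD // ler_wpM2l // ltW.
  exists (a *: d + d'), (a *: w + w'); split; [exact: D0_linear|exact: bd|exact: bd].
pose AL : {linear V -> W} := HB.pack A (GRing.isLinear.Build K V W *:%R A linA).
exists AL; split=> [d w dw|v] /=.
  apply: near_graph_uniq (AP d) _ => e e0.
  by exists d, w; rewrite !subrr !normr0.
apply/eqP; rewrite -subr_eq0 -normr_eq0; apply/negPn/negP => n0.
have e0 : 0 < `| `|A v| - `|v| | / 2 by rewrite divr_gt0 // lt_def n0 /=.
have [d [w [dw vd Aw]]] := AP v _ e0.
have : `| `|A v| - `|v| | < `| `|A v| - `|v| | / 2 + `| `|A v| - `|v| | / 2.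
  have {1}-> : `|A v| - `|v| = (`|A v| - `|w|) - (`|v| - `|d|).
    by rewrite (D0_isometric dw) opprB addrA subrK.
  apply: le_lt_trans (ler_normB _ _) _; apply: ltrD.
    exact: le_lt_trans (ler_dist_dist _ _) Aw.
  exact: le_lt_trans (ler_dist_dist _ _) vd.
by rewrite -splitr ltxx.
Qed.

End Extension.

(** * The intertwining operator *)

(** A bijection fixing all points from n on preserves each initial segment of length m >= n. All
    such m are allowed, so that several elements can be placed in one S(m). *)
Lemma sinf_of_ex (s : Sinf) :
  exists n, forall m, (n <= m)%N -> exists p : 'S_m, sinf_of p = s.
Proof.
have [bij_s [n fix_s]] := sinfP s; exists n => m nm.
have inj_s := bij_inj bij_s.
have lt (i : 'I_m) : (s i < m)%N.
  rewrite ltnNge; apply/negP => mi; have /inj_s si := fix_s _ (leq_trans nm mi).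
  by have := ltn_ord i; rewrite ltnNge -{1}si mi.
have inj : injective (fun i => Ordinal (lt i)).
  by move=> i j /(congr1 val) /= /inj_s /val_inj.
exists (perm inj); apply: sinf_ext => i; rewrite /= /sinf_of_fun.
case: insubP => [j _ <-|ni]; first by rewrite permE.
by rewrite fix_s // (leq_trans nm) // leqNgt.
Qed.

Section Realization.
Variables (R : realType) (z : R[i]) (T : Tz_realization z).
Local Notation C := R[i].

Lemma norm_eq_inner (H K : hilbertType R) (v : H) (w : K) :
  inner H v v = inner K w w -> `|v| = `|w|.
Proof. by rewrite -!norm_inner => /eqP; rewrite eqrXn2 // => /eqP. Qed.

Lemma norm_rep (G : groupType) (H : hilbertType R) (S : unitary_rep G H) g v :
  `|S g v| = `|v|.
Proof. exact/norm_eq_inner/rep_unitary. Qed.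

Lemma emb_Fz n : (0 < n)%N -> emb T n (Fz z n) = distinguished T.
Proof.
case: n => // n _; elim: n => // n IH.
by rewrite -Lz_Fz emb_compatible.
Qed.

Lemma emb_cyclic n (f : Hn R n) : (0 < n)%N -> (forall k : int, z <> k%:~R) ->
  exists (a : 'S_n * 'S_n -> C) (g : 'S_n * 'S_n -> Ginf),
    emb T n f = \sum_u a u *: Tz_rep T (g u) (distinguished T).
Proof.
move=> n0 zn; have [a [g ->]] := Fz_cyclic f zn.
exists a, (fun u => (sinf_of (g u), sinf_of (1%g : 'S_n))).
rewrite linear_sum; apply: eq_bigr => u _; rewrite linearZ /= -(emb_Fz n0).
by congr (_ *: _); rewrite -(emb_equivariant T n0 (g u, 1%g)).
Qed.

End Realization.

(** * Gluing the convolutions into one operator *)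

Section Intertwiner.
Variables (R : realType) (z : R[i]) (T : Tz_realization z) (T' : Tz_realization z^*).
Hypothesis z_nonint : forall k : int, z <> k%:~R.
Local Notation C := R[i].

Local Notation Th n := (convolver (Theta z n)).

(** A relation is used because a vector has representatives at many levels; isometry makes it
    single-valued. *)
Definition Theta_graph (v : T) (w : T') : Prop :=
  exists n (f : Hn R n), [/\ (0 < n)%N, v = emb T n f & w = emb T' n (Th _ f)].

(** Brings vectors to a common level; the convolutions follow because they commute with the
    embeddings [Lz]. *)
Lemma emb_lift m n (f : Hn R n) : (0 < n)%N -> (n <= m)%N ->
  exists f' : Hn R m, emb T m f' = emb T n f /\ emb T' m (Th _ f') = emb T' n (Th _ f).
Proof.
move=> n0; elim: m => [|m IH]; first by rewrite leqn0 => /eqP E; rewrite E in n0.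
rewrite leq_eqVlt => /orP[/eqP E|]; first by case: _ / E; exists f.
rewrite ltnS => nm; have [f' [e e']] := IH nm; have m0 := leq_trans n0 nm.
by exists (Lz z f'); rewrite convolver_Lz // !emb_compatible.
Qed.

Lemma Theta_graph_linear a v w v' w' : Theta_graph v w -> Theta_graph v' w' ->
  Theta_graph (a *: v + v') (a *: w + w').
Proof.
move=> [n [f [n0 -> ->]]] [n' [f' [n0' -> ->]]].
have [h [<- <-]] := emb_lift f n0 (leq_maxl n n').
have [h' [<- <-]] := emb_lift f' n0' (leq_maxr n n').
exists (maxn n n'), (a *: h + h'); split; rewrite ?leq_max ?n0 //.
  by rewrite linearP.
have -> : Th _ (a *: h + h') = a *: Th _ h + Th _ h' by exact: linearP.
by rewrite linearP.
Qed.

Lemma Theta_graph_isometric v w : Theta_graph v w -> `|w| = `|v|.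
Proof.
move=> [n [f [n0 -> ->]]]; apply: norm_eq_inner.
by rewrite !emb_isometric // convolver_isometric.
Qed.

Lemma Theta_graph_dense : dense [set v | exists w, Theta_graph v w].
Proof.
move=> O O0 Oo; have [v [Ov [n [f [n0 vE]]]]] := emb_dense O0 Oo.
by exists v; split=> //; exists (emb T' n (Th _ f)), n, f.
Qed.

Lemma intertwiner_ex : exists A : {linear T -> T'},
  (forall n (f : Hn R n), (0 < n)%N -> A (emb T n f) = emb T' n (Th _ f)) /\
  (forall v, `|A v| = `|v|).
Proof.
have [A [AE Aiso]] := isometric_extension Theta_graph_linear Theta_graph_isometric Theta_graph_dense.
by exists A; split=> // n f n0; apply: AE; exists n, f.
Qed.

End Intertwiner.

Theorem proposition4p5p2 (R : realType) (z : R[i])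
    (z_nonint : forall k : int, z <> k%:~R)
    (T : Tz_realization z) (T' : Tz_realization z^*) :
  let is_Az (A : {linear T -> T'}) :=
    [/\ bounded_operator A,
        intertwines (Tz_rep T) (Tz_rep T') A
      & A (distinguished T) = distinguished T'] in
  exists A : {linear T -> T'},
    [/\ (* (i) *)
        is_Az A,
        (forall B : {linear T -> T'}, is_Az B -> forall v : T, B v = A v)
      & (* (ii) and (iii) *)
        forall n : nat, (0 < n)%N ->
        exists An : {linear Hn R n -> Hn R n},
          [/\ forall f : Hn R n, A (emb T n f) = emb T' n (An f),
              forall (g : 'S_n * 'S_n) (f : Hn R n),
                An (Reg g f) = Reg g (An f),
              central (Theta z n)
            & forall f : Hn R n, An f = convolution f (Theta z n)]].
Proof.
move=> is_Az.
have [A [AE Aiso]] := intertwiner_ex T T' z_nonint.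
have Ale v : `|A v| <= 1 * `|v| by rewrite mul1r Aiso.
have isA : is_Az A.
  split.
  - by exists 1 => v.
  (* Both composites are bounded, so they need only agree on the dense union of the H^n. *)
  - move=> g; apply: (bounded_linear_dense_eq (A := A \o Tz_rep T g)
      (B := Tz_rep T' g \o A) (M := 1) (N := 1) _ _ (@emb_dense _ _ T)).
    + by move=> v; rewrite /= mul1r Aiso norm_rep.
    + by move=> v; rewrite /= mul1r norm_rep Aiso.
    move=> _ [n [f [n0 ->]]] /=; case: g => s t.
    have [ns sP] := sinf_of_ex s; have [nt tP] := sinf_of_ex t.
    (* A level containing the vector and both components of the group element. *)
    pose m := maxn n (maxn ns nt).
    have [p <-] := sP m (leq_trans (leq_maxl _ _) (leq_maxr _ _)).
    have [q <-] := tP m (leq_trans (leq_maxr _ _) (leq_maxr _ _)).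
    have [h [<- _]] := emb_lift T T' z_nonint f n0 (leq_maxl n (maxn ns nt)).
    have m0 : (0 < m)%N by rewrite leq_max n0.
    rewrite (emb_equivariant T m0 (p, q)) !AE // (emb_equivariant T' m0 (p, q)).
    by rewrite convolver_Reg //; apply: Theta_central.
  by rewrite /distinguished AE // convolver_Fz.
exists A; split=> //.
  move=> B [[M BM] Bint Bdist].
  apply: (bounded_linear_dense_eq BM Ale (@emb_dense _ _ T)) => _ [n [f [n0 ->]]].
  have [_ Aint Adist] := isA.
  (* The distinguished vector is cyclic, so its image and the intertwining relation force the value
     here. *)
  have [a [g ->]] := emb_cyclic T f n0 z_nonint.
  rewrite !linear_sum; apply: eq_bigr => u _.
  by rewrite !linearZ /= Bint Aint Bdist Adist.
move=> n n0; exists (convolver (Theta z n)); split=> //.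
- by move=> f; apply: AE.
- by move=> g f; apply: convolver_Reg; apply: Theta_central.
- exact: Theta_central.
Qed.
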